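(* The global minimizer(s) of $E_0$ are given by: (i) the function $$u(x)=e^{i(2\pi N+\alpha)x}$$ having constant twist and no jumps when $$L\alpha^2<\frac{4\sqrt2}{3}\quad\text{and}\quad\alpha\in[0,\pi];$$ (ii) the function $$u(x)=e^{i(2\pi(N-1)+\alpha)x}$$ having constant twist and no jumps when $$L(2\pi-\alpha)^2<\frac{4\sqrt2}{3}\quad\text{and}\quad\alpha\in[\pi,2\pi);$$ (iii) the one-parameter set of functions given by $$u(x)=\begin{cases}e^{i2\pi Nx}&\text{if }x<x_0,\\ e^{i(2\pi Nx+\alpha)}&\text{if }x>x_0,\end{cases}$$ for any $x_0\in(0,1)$, that have one jump and twist $2\pi N$ away from the jump, when $$L\alpha^2>\frac{4\sqrt2}{3}\quad\text{and}\quad L(2\pi-\alpha)^2>\frac{4\sqrt2}{3}.$$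
   Context: Fix a constant $L>0$, a positive integer $N$ and $\alpha\in[0,2\pi)$. Identify $\mathbb{R}^2$ with $\mathbb{C}$ when convenient. The functional $E_0$ on $L^2((0,1);\mathbb{R}^2)$ is $$E_0(u)=\begin{cases}\displaystyle\frac{L}{2}\int_0^1(u_1u_2'-u_2u_1'-2\pi N)^2\,dx+\frac{2\sqrt2}{3}\mathcal{H}^0(J)&\text{if }u\in H^1((0,1)\setminus J;S^1),\\ +\infty&\text{otherwise,}\end{cases}$$ where $\mathcal{H}^0$ is counting measure, and $J$ is a finite (possibly empty) collection of points consisting of points $0<x_1<\dots<x_k<1$ together with possibly $0$ and/or $1$: the point $0$ is included in $J$ only if the trace $u(0^+)\neq1$, and the point $1$ is included in $J$ only if the trace $u(1^-)\neq e^{i\alpha}$ (and they are included in those cases). $J$ is taken to be the minimal such set, meaning that if any point of $J\cap(0,1)$ were removed, $u$ would no longer be an $H^1$ function on the complement of the smaller set. The case ''otherwise'' means that no such finite set exists. Derivatives in $E_0$ are taken on $(0,1)\setminus J$. The twist of $u$ is $u_1u_2'-u_2u_1'$.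
   Formalization: In case (iii) the list of global minimizers also includes the endpoint functions x_0=0 and x_0=1, i.e. e^{i(2πNx+α)} (jump only at 0) and e^{i2πNx} (jump only at 1), which have the same energy 2√2/3; with x_0∈(0,1) alone the list is incomplete. *)

(* Defs.v *)
From HB Require Import structures.
From mathcomp Require Import all_boot all_order all_algebra.
From mathcomp Require Import all_classical all_reals all_analysis.

Set Implicit Arguments.
Unset Strict Implicit.
Unset Printing Implicit Defensive.

Import Order.TTheory GRing.Theory Num.Theory.
Import numFieldNormedType.Exports.

Local Open Scope classical_set_scope.
Local Open Scope ring_scope.

(* Elements of L^2 and H^1 are represented by honest functions R -> R, or
   R -> R * R when they are vector valued.  Everything below depends only on
   the a.e. class on the domain, and values off the domain are irrelevant. *)

Section Sobolev.
Context {R : realType}.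
Implicit Types (D : set R) (f g phi : R -> R) (u : R -> R * R).

Local Notation mu := (@lebesgue_measure R).

Definition inL2 D f : Prop :=
  measurable_fun D f /\ mu.-integrable D (fun x => (f x ^+ 2)%:E).

Definition inL2_R2 D u : Prop :=
  inL2 D (fun x => (u x).1) /\ inL2 D (fun x => (u x).2).

Definition C1_function phi : Prop :=
  (forall x, derivable phi x 1) /\ continuous (derive1 phi).

Definition compactly_supported_in D phi : Prop :=
  exists K : set R, [/\ compact K, K `<=` D & forall x, ~ K x -> phi x = 0].

(* Test functions are C^1_c, a customary choice in dimension one (for instance
   in Brezis' textbook); by mollification C^oo_c gives the same notion. *)
Definition is_weak_derivative D f g : Prop :=
  forall phi, C1_function phi -> compactly_supported_in D phi ->
    \int[mu]_(x in D) (f x * derive1 phi x) = - \int[mu]_(x in D) (g x * phi x).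

Definition inH1 D f : Prop :=
  inL2 D f /\ exists g, inL2 D g /\ is_weak_derivative D f g.

(* Meaningful when f is in H^1(D), D open; then unique up to a.e. equality. *)
Definition weak_derivative D f : R -> R :=
  get [set g | inL2 D g /\ is_weak_derivative D f g].

Definition inH1_S1 D u : Prop :=
  [/\ inH1 D (fun x => (u x).1), inH1 D (fun x => (u x).2) &
      {ae mu, forall x, D x -> (u x).1 ^+ 2 + (u x).2 ^+ 2 = 1}].

Definition twist D u : R -> R := fun x =>
  (u x).1 * weak_derivative D (fun y => (u y).2) x
  - (u x).2 * weak_derivative D (fun y => (u y).1) x.

End Sobolev.

Section Energy.
Context {R : realType}.
Variables (L : R) (N : nat) (alpha : R).
Implicit Types (u : R -> R * R) (J : set R).

Local Notation mu := (@lebesgue_measure R).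

(* e^{i t}, with C identified with R * R *)
Definition expi (t : R) : R * R := (cos t, sin t).

Definition dom : set R := `]0, 1[.

Definition ae_eq_dom u v : Prop := {ae mu, forall x, dom x -> u x = v x}.

(* The trace u(0^+) (resp. u(1^-)) of the class of u is l, for F = 0^'+
   (resp. 1^'-): some representative of u tends to l.  Two representatives
   cannot have different limits; for u in H^1 near the endpoint, the continuous
   representative does converge. *)
Definition has_trace (F : set_system R) u (l : R * R) : Prop :=
  exists w : R -> R * R, ae_eq_dom w u /\ w @ F --> l.

Definition is_jump_set u J : Prop :=
  [/\ finite_set J /\ J `<=` `[0, 1],
      inH1_S1 (dom `\` J) u,
      (forall x, J x -> dom x -> ~ inH1_S1 (dom `\` (J `\ x)) u),
      (J 0 <-> ~ has_trace 0^'+ u (expi 0)) &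
      (J 1 <-> ~ has_trace 1^'- u (expi alpha))].

(* Meaningful when some J satisfies [is_jump_set u]; such a J is unique. *)
Definition jump_set u : set R := get (is_jump_set u).

Definition E0 u : \bar R :=
  if `[< exists J, is_jump_set u J >] then
    let J := jump_set u in
    ((L / 2)%:E *
       (\int[mu]_(x in dom `\` J)
          ((twist (dom `\` J) u x - 2 * pi * N%:R) ^+ 2)%:E)
     + (2 * Num.sqrt 2 / 3)%:E * counting J)%E
  else +oo%E.

Definition global_minimizer u : Prop :=
  inL2_R2 dom u /\ forall v, inL2_R2 dom v -> (E0 u <= E0 v)%E.

Definition has_jump_set u J : Prop :=
  is_jump_set u J /\ jump_set u = J.

Definition has_constant_twist u (c : R) : Prop :=
  {ae mu, forall x, (dom `\` jump_set u) x -> twist (dom `\` jump_set u) u x = c}.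

Definition one_jump (x0 : R) : R -> R * R := fun x =>
  if x < x0 then expi (2 * pi * N%:R * x) else expi (2 * pi * N%:R * x + alpha).

End Energy.

(* Main.v *)
Require Import Defs.
From HB Require Import structures.
From mathcomp Require Import finmap.
From mathcomp Require Import all_boot all_order all_algebra.
From mathcomp Require Import all_classical all_reals all_analysis.
From mathcomp Require Import measurable_realfun.
From mathcomp Require Import zify ring lra.

(** The energy of [u] is, up to the cost of jumps, the squared distance of its
    twist [tau] to the constant [2 pi N], so the proof has to relate the twist
    to the values of [u].

    Lifting.  On an interval free of jumps [u] has an absolutely continuous
    representative [V] with values in the circle, and [V] rotates with angular
    speed [tau]: [u = e^{i theta}] with [theta' = tau] ([twist_lifting]).  Two
    facts give this.  A weak derivative of [f] integrates back to [f]: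
    testing with a smoothed indicator of [[x, y]] gives
    [f y - f x = int_x^y g] at Lebesgue points [x], [y] of [f]
    ([weak_derivative_increment]).  And [V e^{- i theta}] is constant, because
    over any subinterval it changes by at most a constant times the square of
    the increment of a continuous function, and such a map is constant
    ([quadratic_increments_const]); this replaces product and chain rules for
    absolutely continuous functions.

    Lower bound.  If [u] has no jump, the traces force [u(0) = 1] and
    [u(1) = e^{i alpha}], so the mean of [tau] is [alpha + 2 pi k] for some
    integer [k], and the energy is at least [L/2 (alpha + 2 pi k - 2 pi N)^2],
    with equality only for constant twist ([twist_energy_no_jump]).  If [u]
    jumps at all, the energy is at least the cost [2 sqrt 2 / 3] of one jump,
    with equality only for a single jump and twist [2 pi N]; the traces then
    fix the two phases, and [u] is a [one_jump] ([twist_energy_jump]).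

    Comparison.  The bounds are attained by the functions
    [phase_jump c d1 d2 p], for which jump set, twist and energy are
    explicit ([is_jump_set_phase_jump], [E0_phase_jump]).  Among the integers
    [k], only [k = N] and [k = N - 1] compete ([turns_cases]), with energies
    [L/2 alpha^2] and [L/2 (2 pi - alpha)^2]; comparing these with the cost of
    one jump gives the three cases. *)

Set Implicit Arguments.
Unset Strict Implicit.
Unset Printing Implicit Defensive.

Import Order.TTheory GRing.Theory Num.Theory.
Import numFieldNormedType.Exports.

Local Open Scope classical_set_scope.
Local Open Scope ring_scope.
Local Notation mu := lebesgue_measure.
Local Notation L1 D f := (lebesgue_measure.-integrable D (EFin \o f)).

(** * Functions with quadratically small increments *)

(** Cut [[a, b]] into [n + 1] pieces on which [T] increases by the same amount
    [M / (n + 1)], which is possible because [T] is continuous; the total change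
    of [w] is then at most [(n + 1) C (M / (n + 1))^2], which tends to [0]. *)
Lemma quadratic_increments_const (R : realType) (T w : R -> R) (a b C : R) :
  a <= b -> {within `[a, b], continuous T} ->
  (forall x y, a <= x -> x <= y -> y <= b ->
     `|w y - w x| <= C * (T y - T x) ^+ 2) ->
  w b = w a.
Proof.
move=> ab cT wT.
pose M := T b - T a.
have step (n k : nat) (x : R) : a <= x <= b ->
    T x = T a + k%:R * (M / n.+1%:R) ->
    `|w x - w a| <= k%:R * (C * (M / n.+1%:R) ^+ 2).
  elim: k x => [|k IH] x /andP[ax xb].
    rewrite !mul0r addr0 => Tx.
    by apply: le_trans (wT a x _ ax xb) _; rewrite // Tx subrr expr0n mulr0.
  move=> Tx.
  have [y] : exists2 y, y \in `[a, x] & T y = T a + k%:R * (M / n.+1%:R).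
    apply: IVT => //.
      by apply: continuous_subspaceW cT; apply: subset_itvl; rewrite bnd_simp.
    set m := M / _ in Tx *; rewrite Tx -natr1.
    have k0 : 0 <= k%:R :> R by [].
    rewrite ge_min le_max lerDl lerD2l gerDl lerD2l.
    have [m0|/ltW m0] := lerP 0 m.
      by rewrite mulr_ge0// orTb mulrDl lerDl mul1r m0 orbT.
    by rewrite mulr_ge0_le0// orTb mulrDl gerDl mul1r m0 orbT.
  rewrite in_itv/= => /andP[ay yx] Ty.
  have := IH y; rewrite ay (le_trans yx xb) => /(_ isT Ty) {}IH.
  have := wT y x ay yx xb.
  rewrite (_ : T x - T y = M / n.+1%:R); last by rewrite Tx Ty -natr1; ring.
  rewrite -[k.+1%:R]natr1 [(k%:R + 1) * _]mulrDl mul1r => h.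
  rewrite -[w x](subrK (w y)) -addrA addrC.
  by rewrite (le_trans (ler_normD _ _))// lerD.
have bound n : `|w b - w a| <= C * M ^+ 2 / n.+1%:R.
  have := step n n.+1 b; rewrite ab lexx => /(_ isT).
  have n0 : n.+1%:R != 0 :> R by [].
  rewrite mulrCA divff// mulr1 => h; apply: le_trans (h _) _.
    by rewrite /M addrC subrK.
  by rewrite le_eqVlt; apply/orP; left; apply/eqP; field.
apply/eqP; rewrite -subr_eq0 -normr_le0.
have lim : (fun n => C * M ^+ 2 / n.+1%:R) @ \oo --> (C * M ^+ 2 * 0 : R).
  by apply: cvgMr; exact: cvg_harmonic.
by rewrite -(mulr0 (C * M ^+ 2)); apply: (cvgr_to_ge lim); exact: nearW.
Qed.

Lemma MVT_origin (R : realType) (f df : R -> R) :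
  (forall x : R, is_derive x 1 f (df x)) ->
  forall x, exists2 c, `|c| <= `|x| & f x - f 0 = df c * x.
Proof.
move=> fdf x.
have cf a b : {within `[a, b], continuous f}.
  apply: continuous_subspaceT => y; apply/differentiable_continuous.
  by apply/derivable1_diffP; case: (fdf y).
have [x0|/ltW x0] := lerP 0 x.
  have [c] := MVT_segment x0 (fun y _ => fdf y) (cf _ _).
  rewrite in_itv/= subr0 => /andP[c0 cx] ->; exists c => //.
  by rewrite !ger0_norm.
have [c] := MVT_segment x0 (fun y _ => fdf y) (cf _ _).
rewrite in_itv/= sub0r => /andP[c0 cx] e; exists c.
  by rewrite !ler0_norm// lerN2.
by rewrite -opprB e mulrN opprK.
Qed.

Lemma normr_sin_le (R : realType) (x : R) : `|sin x| <= `|x|.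
Proof.
have [c _] := MVT_origin (fun x => is_derive_sin x) x.
by rewrite sin0 subr0 => ->; rewrite normrM ler_piMl// cos_max.
Qed.

Lemma cos_sub1_le (R : realType) (x : R) : `|cos x - 1| <= `|x|.
Proof.
have [c _] := MVT_origin (fun x => is_derive_cos x) x.
by rewrite cos0 => ->; rewrite normrM normrN ler_piMl// sin_max.
Qed.

Lemma cos_sub1_le_sqr (R : realType) (x : R) : `|cos x - 1| <= x ^+ 2.
Proof.
have [c cx] := MVT_origin (fun x => is_derive_cos x) x.
rewrite cos0 => ->; rewrite normrM normrN -(@real_normK _ x) ?num_real// expr2.
by apply: ler_wpM2r => //; apply: le_trans (normr_sin_le _) cx.
Qed.

Lemma sin_sub_le_sqr (R : realType) (x : R) : `|sin x - x| <= x ^+ 2.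
Proof.
have [c cx] := MVT_origin (fun x => is_derive_sin x) x.
rewrite sin0 subr0 => ->; rewrite -{2}[x]mul1r -mulrBl normrM.
rewrite -(@real_normK _ x) ?num_real// expr2.
by apply: ler_wpM2r => //; apply: le_trans (cos_sub1_le _) cx.
Qed.

(** One step of the lifting argument, for a unit vector [p] moved to the unit
    vector [p + d] while the angle [t] grows by [dt].  If [d] is of size [D] and
    its component along the direction orthogonal to [p] is [dt] up to [2 D^2],
    then the coordinates in the frame rotated by the angle change only by
    [O(D^2)].  The radial component of [d] is itself [O(D^2)], since both vectors
    have norm one.  The constant is not optimal. *)
Lemma rotation_increment (R : realType) (p1 p2 d1 d2 t dt D : R) :
  p1 ^+ 2 + p2 ^+ 2 = 1 -> (p1 + d1) ^+ 2 + (p2 + d2) ^+ 2 = 1 ->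
  `|d1| <= D -> `|d2| <= D -> `|dt| <= D + D ->
  `|p1 * d2 - p2 * d1 - dt| <= D ^+ 2 + D ^+ 2 ->
  `|((p1 + d1) * cos (t + dt) + (p2 + d2) * sin (t + dt)) -
     (p1 * cos t + p2 * sin t)| <= 100 * D ^+ 2 /\
  `|((p2 + d2) * cos (t + dt) - (p1 + d1) * sin (t + dt)) -
     (p2 * cos t - p1 * sin t)| <= 100 * D ^+ 2.
Proof.
move=> p1E pd1E d1D d2D dtD.
(* radial and angular components of d *)
set A := p1 * d1 + p2 * d2; set B := p1 * d2 - p2 * d1 => BD.
have D0 : 0 <= D by apply: le_trans d1D.
have p1_le : `|p1| <= 1 by rewrite ler_norml; apply/andP; split; nra.
have p2_le : `|p2| <= 1 by rewrite ler_norml; apply/andP; split; nra.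
have d1E : d1 = p1 * A - p2 * B.
  by rewrite -[LHS]mul1r -p1E /A /B; ring.
have d2E : d2 = p2 * A + p1 * B.
  by rewrite -[LHS]mul1r -p1E /A /B; ring.
have mulD u v (a b : R) : `|u| <= a -> `|v| <= b -> `|u * v| <= a * b.
  by move=> ua vb; rewrite normrM ler_pM.
have A2 : A = - (d1 ^+ 2 + d2 ^+ 2) / 2 by rewrite /A; lra.
have AD : `|A| <= D ^+ 2.
  have h1 := mulD _ _ _ _ d1D d1D; have h2 := mulD _ _ _ _ d2D d2D.
  rewrite -!expr2 ger0_norm ?sqr_ge0// in h1.
  rewrite -!expr2 ger0_norm ?sqr_ge0// in h2.
  rewrite A2 mulNr normrN ger0_norm ?divr_ge0 ?addr_ge0 ?sqr_ge0//.
  lra.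
have BD' : `|B| <= D + D.
  rewrite (le_trans (ler_normB _ _))// lerD//.
    by have := mulD _ _ _ _ p1_le d2D; rewrite mul1r.
  by have := mulD _ _ _ _ p2_le d1D; rewrite mul1r.
(* X + i Y = e^{- i dt} (1 + A + i B) - 1, the relative change in the frame *)
pose X := cos dt - 1 + A * cos dt + B * sin dt.
pose Y := (B - dt) * cos dt + dt * (cos dt - 1) - (sin dt - dt) - A * sin dt.
have dt2 : dt ^+ 2 <= 4 * D ^+ 2.
  have := mulD _ _ _ _ dtD dtD; rewrite -expr2 ger0_norm ?sqr_ge0//.
  move=> h; apply: le_trans h _; rewrite le_eqVlt; apply/orP; left.
  by apply/eqP; ring.
have XD : `|X| <= 20 * D ^+ 2.
  have h1 := cos_sub1_le_sqr dt.
  have := mulD _ _ _ _ AD (cos_max dt).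
  have := mulD _ _ _ _ BD' (le_trans (normr_sin_le dt) dtD).
  have := ler_normD (cos dt - 1 + A * cos dt) (B * sin dt).
  have := ler_normD (cos dt - 1) (A * cos dt).
  rewrite -/X; nra.
have YD : `|Y| <= 20 * D ^+ 2.
  have h1 := sin_sub_le_sqr dt.
  have h2 := mulD _ _ _ _ AD (sin_max dt).
  have h3 := mulD _ _ _ _ dtD (le_trans (cos_sub1_le dt) dtD).
  have h4 := mulD _ _ _ _ BD (cos_max dt).
  have h5 := ler_normB
    ((B - dt) * cos dt + dt * (cos dt - 1) - (sin dt - dt)) (A * sin dt).
  have h6 := ler_normB ((B - dt) * cos dt + dt * (cos dt - 1)) (sin dt - dt).
  have h7 := ler_normD ((B - dt) * cos dt) (dt * (cos dt - 1)).
  rewrite -/Y in h5; nra.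
have qD (c s : R) : `|c| <= 1 -> `|s| <= 1 ->
   `|(p1 * c + p2 * s) * X - (p2 * c - p1 * s) * Y| <= 100 * D ^+ 2 /\
   `|(p1 * c + p2 * s) * Y + (p2 * c - p1 * s) * X| <= 100 * D ^+ 2.
  move=> c1 s1.
  have q1 : `|p1 * c + p2 * s| <= 2.
    have := mulD _ _ _ _ p1_le c1; have := mulD _ _ _ _ p2_le s1.
    by have := ler_normD (p1 * c) (p2 * s); lra.
  have q2 : `|p2 * c - p1 * s| <= 2.
    have := mulD _ _ _ _ p2_le c1; have := mulD _ _ _ _ p1_le s1.
    by have := ler_normB (p2 * c) (p1 * s); lra.
  have := mulD _ _ _ _ q1 XD; have := mulD _ _ _ _ q2 XD.
  have := mulD _ _ _ _ q1 YD; have := mulD _ _ _ _ q2 YD.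
  have := ler_normB ((p1 * c + p2 * s) * X) ((p2 * c - p1 * s) * Y).
  have := ler_normD ((p1 * c + p2 * s) * Y) ((p2 * c - p1 * s) * X).
  by move=> *; split; nra.
have [h1 h2] := qD _ _ (cos_max t) (sin_max t).
split.
  apply: le_trans h1; rewrite le_eqVlt; apply/orP; left; apply/eqP; congr `|_|.
  rewrite cosD sinD {1}d1E {1}d2E /X /Y; ring.
apply: le_trans h2; rewrite le_eqVlt; apply/orP; left; apply/eqP; congr `|_|.
rewrite cosD sinD {1}d1E {1}d2E /X /Y; ring.
Qed.

(** * Integrable real functions *)

Section Integrable.
Context {R : realType}.
Implicit Types (D : set R) (f g h : R -> R) (a b x y : R).

Lemma L1D D f g : measurable D -> L1 D f -> L1 D g -> L1 D (f \+ g).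
Proof.
move=> mD fi gi.
have -> : EFin \o (f \+ g) = ((EFin \o f) \+ (EFin \o g))%E by [].
exact: integrableD.
Qed.

Lemma L1B D f g : measurable D -> L1 D f -> L1 D g -> L1 D (f \- g).
Proof.
move=> mD fi gi.
have -> : EFin \o (f \- g) = ((EFin \o f) \- (EFin \o g))%E by [].
exact: integrableB.
Qed.

Lemma L1Z D (k : R) f : measurable D -> L1 D f -> L1 D (fun x => k * f x).
Proof.
move=> mD fi.
have -> : EFin \o (fun x => k * f x) = (fun x => k%:E * (EFin \o f) x)%E by [].
exact: integrableZl.
Qed.

Lemma L1_norm D f : L1 D f -> L1 D (fun x => `|f x|).
Proof. exact: integrable_norm. Qed.

Lemma L1_measurable D f : L1 D f -> measurable_fun D f.
Proof. by case/integrableP => /measurable_EFinP. Qed.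

Lemma L1_le D f g : measurable D -> measurable_fun D f ->
  (forall x, D x -> `|f x| <= g x) -> L1 D g -> L1 D f.
Proof.
move=> mD mf fg; apply: le_integrable => //; first exact/measurable_EFinP.
by move=> x Dx /=; rewrite lee_fin (le_trans (fg _ Dx))// ler_norm.
Qed.

Lemma L1_bounded_mul D h g (M : R) : measurable D -> measurable_fun D h ->
  (forall x, D x -> `|h x| <= M) -> L1 D g -> L1 D (fun x => h x * g x).
Proof.
move=> mD mh hM gi; apply: (@L1_le _ _ (fun x => M * `|g x|)) => //.
- by apply: measurable_funM => //; exact: L1_measurable.
- by move=> x Dx; rewrite normrM ler_wpM2r// hM.
- by apply: L1Z => //; exact: L1_norm.
Qed.

Lemma L1_itv f a b x y : a <= x -> y <= b -> L1 `[a, b] f -> L1 `[x, y] f.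
Proof.
move=> ax yb; apply: integrableS => //.
by apply: subset_itvScc; rewrite bnd_simp.
Qed.

Lemma Rintegral_increment f a b x y : a <= x -> x <= y -> y <= b ->
  L1 `[a, b] f ->
  \int[mu]_(t in `[a, y]) f t - \int[mu]_(t in `[a, x]) f t =
  \int[mu]_(t in `[x, y]) f t.
Proof.
move=> ax xy yb fi; rewrite Rintegral_itvB ?bnd_simp//; last exact: L1_itv fi.
rewrite Rintegral_itv_obnd_cbnd//.
by apply: integrableS fi => //; apply: subset_itv; rewrite bnd_simp.
Qed.

Lemma Rintegral_increment_le f h a b x y : a <= x -> x <= y -> y <= b ->
  L1 `[a, b] f -> L1 `[a, b] h -> (forall t, x <= t <= y -> `|f t| <= h t) ->
  `|\int[mu]_(t in `[a, y]) f t - \int[mu]_(t in `[a, x]) f t| <=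
  \int[mu]_(t in `[a, y]) h t - \int[mu]_(t in `[a, x]) h t.
Proof.
move=> ax xy yb fi hi fh.
have fi' : L1 `[x, y] f by exact: L1_itv fi.
rewrite !(@Rintegral_increment _ a b)//.
apply: le_trans (le_normr_Rintegral _ _) _ => //.
apply: le_Rintegral => //; first exact: (L1_norm fi').
exact: L1_itv hi.
Qed.

End Integrable.

(** * Angles on the unit circle *)

Lemma expi_periodic (R : realType) (x : R) (k : int) :
  expi (x + 2 * pi * k%:~R) = expi x.
Proof.
have nat_case (n : nat) (y : R) : expi (y + 2 * pi * n%:R) = expi y.
  rewrite /expi (_ : 2 * pi * n%:R = pi *+ 2 *+ n); last first.
    by rewrite -[RHS]mulr_natr -[pi *+ 2]mulr_natl.
  congr pair; first exact: (periodicn (@cosD2pi R)).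
  exact: (periodicn (@sinD2pi R)).
case: k => n; first exact: nat_case.
rewrite -(nat_case n.+1 (x + _)); congr expi.
by rewrite NegzE mulrNz mulrN subrK.
Qed.

Lemma expi_eq (R : realType) (x y : R) :
  expi x = expi y -> exists k : int, x = y + 2 * pi * k%:~R.
Proof.
move=> [cxy sxy]; have pi0 := pi_gt0 R.
have c1 : cos (x - y) = 1 by rewrite cosB cxy sxy -!expr2 cos2Dsin2.
pose k := Num.floor ((x - y) / (2 * pi)); exists k.
pose r := x - y - 2 * pi * k%:~R.
have cr : cos r = 1.
  by rewrite -c1; have [<- _] := expi_periodic r k; rewrite subrK.
have /andP[k1 k2] := mem_rg1_floor ((x - y) / (2 * pi)); rewrite -/k in k1 k2.
have r0 : 0 <= r.
  by rewrite subr_ge0 mulrC -ler_pdivlMr// mulr_gt0.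
have r2 : r < 2 * pi.
  by move: k2; rewrite ltr_pdivrMr ?mulr_gt0// ?intrD /r => k2; lra.
suff : r = 0 by rewrite /r; lra.
have in0 : (0 : R) \in `[0, pi] by rewrite in_itv/= lexx ltW.
have [rpi|rpi] := lerP r pi.
  by apply: cos_inj => //; [rewrite in_itv/= r0 rpi|rewrite cr cos0].
have : 2 * pi - r = 0.
  apply: cos_inj => //; first by rewrite in_itv/=; apply/andP; split; lra.
  rewrite cos0 -cosN opprB (_ : 2 * pi = pi *+ 2) ?mulr_natl//.
  by rewrite -(cosD2pi (r - _)) subrK.
lra.
Qed.

Lemma expi_surj (R : realType) (p q : R) :
  p ^+ 2 + q ^+ 2 = 1 -> exists c, expi c = (p, q).
Proof.
move=> pq; have p1 : -1 <= p <= 1 by apply/andP; split; nra.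
have sE : Num.sqrt (1 - p ^+ 2) = `|q|.
  by rewrite -sqrtr_sqr; congr Num.sqrt; lra.
have [q0|q0] := lerP 0 q.
  by exists (acos p); rewrite /expi acosK// sin_acos// sE ger0_norm.
exists (- acos p); rewrite /expi cosN sinN acosK// sin_acos// sE.
by rewrite ltr0_norm// opprK.
Qed.

(** * Lifting of curves in the circle *)

(** The curve [V] seen in the frame rotated by [theta = int (V1 g2 - V2 g1)] has
    coordinates [w1], [w2].  By [rotation_increment], with [D] the increment of
    [T = int (|g1| + |g2|)], their increments are [O((T y - T x)^2)], so they are
    constant. *)
Lemma angle_lifting (R : realType) (g1 g2 V1 V2 : R -> R) (a b : R) :
  a <= b -> L1 `[a, b] g1 -> L1 `[a, b] g2 ->
  (forall x, a <= x <= b -> V1 x = V1 a + \int[mu]_(t in `[a, x]) g1 t) ->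
  (forall x, a <= x <= b -> V2 x = V2 a + \int[mu]_(t in `[a, x]) g2 t) ->
  (forall x, a <= x <= b -> V1 x ^+ 2 + V2 x ^+ 2 = 1) ->
  L1 `[a, b] (fun t => V1 t * g2 t - V2 t * g1 t) /\
  exists c, forall x, a <= x <= b -> (V1 x, V2 x) =
    expi (c + \int[mu]_(t in `[a, x]) (V1 t * g2 t - V2 t * g1 t)).
Proof.
move=> ab g1i g2i V1E V2E V1V2.
have cV (V g : R -> R) : L1 `[a, b] g ->
    (forall x, a <= x <= b -> V x = V a + \int[mu]_(t in `[a, x]) g t) ->
    {within `[a, b], continuous V}.
  move=> gi VE.
  apply: (@subspace_eq_continuous _ _ _
    (fun x => V a + \int[mu]_(t in `[a, x]) g t)).
    by move=> x; rewrite inE/= in_itv/= => /VE.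
  move=> x; apply: cvgD; first exact: cvg_cst.
  exact: (parameterized_integral_continuous ab gi).
have mV (V : R -> R) : {within `[a, b], continuous V} -> measurable_fun `[a, b] V.
  exact: subspace_continuous_measurable_fun.
have mV1 := mV _ (cV _ _ g1i V1E); have mV2 := mV _ (cV _ _ g2i V2E).
have V1_le x : a <= x <= b -> `|V1 x| <= 1.
  by move=> /V1V2 h; rewrite ler_norml; apply/andP; split; nra.
have V2_le x : a <= x <= b -> `|V2 x| <= 1.
  by move=> /V1V2 h; rewrite ler_norml; apply/andP; split; nra.
have cancel (c p q : R) : c + p - (c + q) = p - q by ring.
have in_ab x : [set` `[a, b]] x -> a <= x <= b by rewrite /= in_itv.
pose h t := V1 t * g2 t - V2 t * g1 t.
have V1g2 : L1 `[a, b] (fun t => V1 t * g2 t).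
  by apply: (L1_bounded_mul _ mV1 (fun x hx => V1_le x (in_ab x hx))).
have V2g1 : L1 `[a, b] (fun t => V2 t * g1 t).
  by apply: (L1_bounded_mul _ mV2 (fun x hx => V2_le x (in_ab x hx))).
have hi : L1 `[a, b] h by exact: L1B.
split=> //.
pose H t := `|g1 t| + `|g2 t|.
have Hi : L1 `[a, b] H by apply: L1D => //; exact: L1_norm.
pose I f x := \int[mu]_(t in `[a, x]) f t.
pose T := I H.
pose w1 x := V1 x * cos (I h x) + V2 x * sin (I h x).
pose w2 x := V2 x * cos (I h x) - V1 x * sin (I h x).
have key x y : a <= x -> x <= y -> y <= b ->
    `|w1 y - w1 x| <= 100 * (T y - T x) ^+ 2 /\
    `|w2 y - w2 x| <= 100 * (T y - T x) ^+ 2.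
  move=> ax xy yb.
  have xab : a <= x <= b by rewrite ax (le_trans xy).
  have yab : a <= y <= b by rewrite yb (le_trans ax).
  have d1D z : x <= z <= y -> `|V1 z - V1 x| <= T z - T x.
    move=> /andP[xz zy]; rewrite [V1 z]V1E ?[V1 x]V1E//; last first.
      by rewrite (le_trans ax xz) (le_trans zy yb).
    rewrite cancel; apply: (@Rintegral_increment_le _ _ _ _ b) => //.
      exact: le_trans yb.
    by move=> t _; rewrite lerDl.
  have d2D z : x <= z <= y -> `|V2 z - V2 x| <= T z - T x.
    move=> /andP[xz zy]; rewrite [V2 z]V2E ?[V2 x]V2E//; last first.
      by rewrite (le_trans ax xz) (le_trans zy yb).
    rewrite cancel; apply: (@Rintegral_increment_le _ _ _ _ b) => //.
      exact: le_trans yb.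
    by move=> t _; rewrite lerDr.
  have Tle z : x <= z <= y -> T z - T x <= T y - T x.
    move=> /andP[xz zy]; rewrite lerD2r -subr_ge0.
    apply: le_trans (normr_ge0 (T z - T z)) _; rewrite subrr normr0.
    rewrite (@Rintegral_increment _ _ _ b)//; last exact: le_trans ax xz.
    by apply: Rintegral_ge0 => t _; exact: addr_ge0.
  have tab t : x <= t <= y -> a <= t <= b.
    by move=> /andP[xt ty]; rewrite (le_trans ax xt) (le_trans ty yb).
  have dt : `|I h y - I h x| <= T y - T x.
    apply: (@Rintegral_increment_le _ _ _ _ b) => // t /tab tin.
    rewrite (le_trans (ler_normB _ _))// !normrM addrC lerD//.
      by rewrite ler_piMl// V2_le.
    by rewrite ler_piMl// V1_le.
  have T0 : 0 <= T y - T x by exact: le_trans dt.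
  have -> : w1 y = (V1 x + (V1 y - V1 x)) * cos (I h x + (I h y - I h x)) +
                   (V2 x + (V2 y - V2 x)) * sin (I h x + (I h y - I h x)).
    by rewrite !subrKC.
  have -> : w2 y = (V2 x + (V2 y - V2 x)) * cos (I h x + (I h y - I h x)) -
                   (V1 x + (V1 y - V1 x)) * sin (I h x + (I h y - I h x)).
    by rewrite !subrKC.
  apply: rotation_increment.
  - exact: V1V2.
  - by rewrite !subrKC V1V2.
  - by apply: d1D; rewrite xy lexx.
  - by apply: d2D; rewrite xy lexx.
  - by rewrite (le_trans dt)// lerDl.
  have L1xy f : L1 `[a, b] f -> L1 `[x, y] f by exact: L1_itv.
  have dV1 : V1 y - V1 x = \int[mu]_(t in `[x, y]) g1 t.
    by rewrite V1E// [V1 x]V1E// cancel (@Rintegral_increment _ _ a b).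
  have dV2 : V2 y - V2 x = \int[mu]_(t in `[x, y]) g2 t.
    by rewrite V2E// [V2 x]V2E// cancel (@Rintegral_increment _ _ a b).
  (* freezing V at x in the integrand of theta costs at most (T y - T x)^2 *)
  pose k t := (V1 x * g2 t - V2 x * g1 t) - h t.
  have ki0 : L1 `[x, y] (fun t => V1 x * g2 t - V2 x * g1 t).
    by apply: L1B => //; apply: L1Z => //; exact: L1xy.
  have ki : L1 `[x, y] k by apply: L1B => //; exact: L1xy.
  have -> : V1 x * (V2 y - V2 x) - V2 x * (V1 y - V1 x) - (I h y - I h x) =
     \int[mu]_(t in `[x, y]) k t.
    rewrite RintegralB//; last exact: L1xy.
    rewrite RintegralB//; [|by apply: L1Z => //; exact: L1xy..].
    rewrite !RintegralZl//; [|exact: L1xy..].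
    by rewrite -dV1 -dV2 (@Rintegral_increment _ _ a b).
  apply: le_trans (le_normr_Rintegral _ _) _ => //.
  apply: (@le_trans _ _ (\int[mu]_(t in `[x, y]) ((T y - T x) * H t))).
    apply: le_Rintegral => //.
    - exact: (L1_norm ki).
    - by apply: L1Z => //; exact: L1xy.
    move=> t; rewrite /= in_itv/= => tin.
    have -> : k t = (V2 t - V2 x) * g1 t - (V1 t - V1 x) * g2 t.
      by rewrite /k /h; ring.
    rewrite (le_trans (ler_normB _ _))// !normrM mulrDr lerD// ler_wpM2r//.
      by apply: le_trans (Tle _ tin); apply: d2D.
    by apply: le_trans (Tle _ tin); apply: d1D.
  rewrite RintegralZl//; last exact: L1xy.
  by rewrite -(@Rintegral_increment _ _ a b)// -expr2 lerDl sqr_ge0.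
have w_const (w : R -> R) x : a <= x <= b ->
    (forall x y, a <= x -> x <= y -> y <= b ->
    `|w y - w x| <= 100 * (T y - T x) ^+ 2) -> w x = w a.
  move=> /andP[ax xb] hw; apply: (@quadratic_increments_const _ T w a x 100) => //.
    apply: (parameterized_integral_continuous ax); exact: L1_itv Hi.
  by move=> y z ay yz zx; apply: hw => //; exact: le_trans xb.
have I0 : I h a = 0 by rewrite /I set_itv1 Rintegral_set1.
have [c cE] := expi_surj (V1V2 a (andb_true_intro (conj (lexx a) ab))).
exists c => x xab.
have w1E : w1 x = V1 a.
  rewrite (w_const w1 x xab); last first.
    by move=> y z ay yz zb; have [] := key _ _ ay yz zb.
  by rewrite /w1 I0 cos0 sin0 mulr1 mulr0 addr0.
have w2E : w2 x = V2 a.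
  rewrite (w_const w2 x xab); last first.
    by move=> y z ay yz zb; have [] := key _ _ ay yz zb.
  by rewrite /w2 I0 cos0 sin0 mulr1 mulr0 subr0.
move: cE => [c1 c2]; rewrite -/(I h x) /expi cosD sinD c1 c2 -w1E -w2E /w1 /w2.
have cs := cos2Dsin2 (I h x).
congr pair.
  by rewrite -[LHS]mulr1 -cs; ring.
by rewrite -[LHS]mulr1 -cs; ring.
Qed.

(** * A C^1 ramp and its derivative *)

Section Ramp.
Context {R : realType}.
Implicit Types (x e t c : R).

Let pos (t : R) : R := Num.max t 0.

Lemma is_derive_quadratic_error (f : R -> R) (x d : R) :
  (forall h, `|f (x + h) - f x - h * d| <= h ^+ 2) -> is_derive x 1 f d.
Proof.
move=> fd.
have lim : h^-1 *: (f (h *: (1 : R) + x) - f x) @[h --> 0^'] --> d.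
  apply/cvgrPdist_le => /= eps eps0; near=> h.
  have h0 : h != 0 by near: h; exact: nbhs_dnbhs_neq.
  rewrite [h *: 1]mulr1 [h + x]addrC distrC.
  have -> : h^-1 *: (f (x + h) - f x) - d = h^-1 * (f (x + h) - f x - h * d).
    by rewrite mulrBr mulKf.
  rewrite normrM normfV ler_pdivrMl ?normr_gt0//.
  apply: le_trans (fd h) _; rewrite -(@real_normK _ h) ?num_real// expr2.
  rewrite ler_wpM2l//.
  near: h; apply: dnbhs0_le => //.
apply: DeriveDef; first by apply/cvg_ex; exists d.
by apply/cvg_lim => //; exact: lim.
Unshelve. all: by end_near. Qed.

Lemma is_derive_pos_sqr c t :
  is_derive t 1 (fun t => pos (t - c) ^+ 2) (2 * pos (t - c)).
Proof.
apply: is_derive_quadratic_error => h; rewrite /pos ler_norml.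
by case: (lerP (t + h - c)) => h1; case: (lerP (t - c)) => h2;
  apply/andP; split; nra.
Qed.

(** The triangle of area [1] over [[x, x + e]]. *)
Definition tent x e t : R :=
  e ^- 2 * (4 * pos (t - x) - 8 * pos (t - (x + e / 2)) + 4 * pos (t - (x + e))).

(** The quadratic spline that climbs from [0] at [x] to [1] at [x + e]; a
    difference of two ramps is a C^1 substitute for the indicator function of an
    interval. *)
Definition ramp x e t : R :=
  e ^- 2 * (2 * pos (t - x) ^+ 2 - 4 * pos (t - (x + e / 2)) ^+ 2
            + 2 * pos (t - (x + e)) ^+ 2).

Lemma is_derive_ramp x e t : is_derive t 1 (ramp x e) (tent x e t).
Proof.
rewrite /ramp /tent.
have h1 := is_derive_pos_sqr x t.
have h2 := is_derive_pos_sqr (x + e / 2) t.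
have h3 := is_derive_pos_sqr (x + e) t.
apply: is_derive_eq; rewrite /GRing.scale/=.
by ring.
Qed.

Lemma continuous_ramp x e : continuous (ramp x e).
Proof.
move=> t; apply/differentiable_continuous/derivable1_diffP.
by case: (is_derive_ramp x e t).
Qed.

Lemma continuous_tent x e : continuous (tent x e).
Proof.
move=> t; rewrite /tent.
have cp c : pos (s - c) @[s --> t] --> pos (t - c).
  have := @continuous_max R R (fun s => s - c) (cst 0) t; apply.
    by apply: cvgB; [exact: cvg_id|exact: cvg_cst].
  exact: cvg_cst.
apply: cvgMr; apply: cvgD; last by apply: cvgMr.
by apply: cvgB; apply: cvgMr.
Qed.

Lemma tent_left x e t : 0 < e -> t <= x -> tent x e t = 0.
Proof.
move=> e0 tx; rewrite /tent /pos !max_r; first by ring.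
all: lra.
Qed.

Lemma tent_right x e t : 0 < e -> x + e <= t -> tent x e t = 0.
Proof.
move=> e0 tx; rewrite /tent /pos !max_l; first by field; rewrite gt_eqF.
all: lra.
Qed.

Lemma tent_bound x e t : 0 < e -> `|tent x e t| <= 2 / e.
Proof.
move=> e0; have e20 : 0 < e ^+ 2 by rewrite exprn_gt0.
rewrite /tent normrM ger0_norm ?invr_ge0 ?sqr_ge0// ler_pdivrMl//.
rewrite (_ : e ^+ 2 * (2 / e) = 2 * e); last by field; rewrite gt_eqF.
rewrite ler_norml /pos.
by case: (lerP (t - x)) => h1; case: (lerP (t - (x + e / 2))) => h2;
  case: (lerP (t - (x + e))) => h3; apply/andP; split; nra.
Qed.

Lemma ramp_left x e t : 0 < e -> t <= x -> ramp x e t = 0.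
Proof.
move=> e0 tx; rewrite /ramp /pos !max_r; first by ring.
all: lra.
Qed.

Lemma ramp_right x e t : 0 < e -> x + e <= t -> ramp x e t = 1.
Proof.
move=> e0 tx; rewrite /ramp /pos !max_l; first by field; rewrite gt_eqF.
all: lra.
Qed.

Lemma ramp_ge0 x e t : 0 < e -> 0 <= ramp x e t.
Proof.
move=> e0; rewrite /ramp mulr_ge0 ?invr_ge0 ?sqr_ge0// /pos.
by case: (lerP (t - x)) => h1; case: (lerP (t - (x + e / 2))) => h2;
  case: (lerP (t - (x + e))) => h3; nra.
Qed.

Lemma ramp_le1 x e t : 0 < e -> ramp x e t <= 1.
Proof.
move=> e0; have e20 : 0 < e ^+ 2 by rewrite exprn_gt0.
rewrite /ramp ler_pdivrMl// mulr1 /pos.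
by case: (lerP (t - x)) => h1; case: (lerP (t - (x + e / 2))) => h2;
  case: (lerP (t - (x + e))) => h3; nra.
Qed.

End Ramp.

(** * Lebesgue points and weak derivatives *)

Section LebesguePoints.
Context {R : realType}.
Implicit Types (D K : set R) (f g h : R -> R) (a b x y e : R).

Lemma Rintegral_support D K h : K `<=` D ->
  (forall t, D t -> ~ K t -> h t = 0) ->
  \int[mu]_(t in D) h t = \int[mu]_(t in K) h t.
Proof.
move=> KD h0; rewrite Rintegral_mkcond [RHS]Rintegral_mkcond.
apply: eq_Rintegral => t _; rewrite !patchE.
have [tK|tK] := boolP (t \in K).
  by rewrite (mem_set (KD _ (set_mem tK))).
have [tD|//] := boolP (t \in D).
apply: h0; first exact: set_mem.
by move=> Kt; move/negP: tK; apply; exact: mem_set.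
Qed.

Lemma Rintegral_patch D f h :
  \int[mu]_(t in D) (f t * h t) = \int[mu]_t ((f \_ D) t * h t).
Proof.
rewrite Rintegral_mkcond; apply: eq_Rintegral => t _; rewrite !patchE.
by case: (t \in D) => //; rewrite mul0r.
Qed.

Lemma L1_patch D f : measurable D -> L1 D f -> L1 setT (f \_ D).
Proof.
by move=> mD fi; rewrite -restrict_EFin; apply/integrable_restrict; rewrite ?setTI.
Qed.

Lemma measurable_tent x e D : measurable D -> measurable_fun D (tent x e).
Proof.
move=> mD; apply: measurable_funS measurableT _ _ => //.
by apply: continuous_measurable_fun; exact: continuous_tent.
Qed.

Lemma L1_tent f x e D : 0 < e -> measurable D -> L1 D f ->
  L1 D (fun t => tent x e t * f t).
Proof.
move=> e0 mD fi; apply: (L1_bounded_mul (M := 2 / e)) => //.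
  exact: measurable_tent.
by move=> t _; exact: tent_bound.
Qed.

Lemma integral_tent x e : 0 < e -> \int[mu]_(t in `[x, x + e]) tent x e t = 1.
Proof.
move=> e0; rewrite /Rintegral (@continuous_FTC2 _ _ (ramp x e)) ?ltrDl//.
- by rewrite /= [ramp x e x]ramp_left// ramp_right// subr0.
- by apply: continuous_subspaceT => t; exact: continuous_tent.
- have c t : {for t, continuous (ramp x e)} by exact: continuous_ramp.
  split.
  + by move=> t _; case: (is_derive_ramp x e t).
  + by apply: cvg_at_right_filter; exact: c.
  + by apply: cvg_at_left_filter; exact: c.
- move=> t _; rewrite derive1E; have h := is_derive_ramp x e t.
  by rewrite derive_val.
Qed.

(** Since the tent is at most [2 / e] and lives in [ball x e], averaging
    [f - f x] against it is bounded by [4] times the mean of [|f - f x|] over the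
    ball, which vanishes in the limit at a Lebesgue point. *)
Lemma tent_cvg f x : L1 setT f -> lebesgue_pt f x ->
  \int[mu]_t (f t * tent x e t) @[e --> 0^'+] --> f x.
Proof.
move=> fi fx; apply/cvgrPdist_le => eps eps0.
have := fx => /fine_cvgP[_ /cvgrPdist_le/(_ (eps / 4))].
rewrite divr_gt0// => /(_ isT); apply: filterS2 (nbhs_right_gt 0) => e e0.
rewrite sub0r normrN distrC => davg_le.
have bsupp t : ~ ball x e t -> tent x e t = 0.
  rewrite ball_itv /= in_itv/= => /negP; rewrite negb_and -!leNgt => /orP[h|h].
    by rewrite tent_left//; lra.
  by rewrite tent_right//; lra.
have bT h : \int[mu]_t (h t * tent x e t) =
            \int[mu]_(t in ball x e) (h t * tent x e t).
  by apply: Rintegral_support => // t _ /bsupp ->; rewrite mulr0.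
have mb : measurable (ball x e) by exact: measurable_ball.
have ib : L1 (ball x e) (fun=> 1).
  apply: measurable_bounded_integrable => //.
    rewrite [X in (X < _)%E](_ : _ = (e *+ 2)%:E) ?ltry//.
    exact: lebesgue_measure_ball (ltW e0).
  by exists 1; split => // M M1 t _; rewrite normr1 ltW.
have fb : L1 (ball x e) f by apply: integrableS fi.
have I1 : \int[mu]_(t in ball x e) (1 * tent x e t) = 1.
  rewrite -bT -[RHS](integral_tent x e0).
  rewrite (@Rintegral_support setT `[x, x + e])//.
    by under eq_Rintegral do rewrite mul1r.
  move=> t _ /=; rewrite in_itv/= => /negP; rewrite negb_and -!ltNge mul1r.
  move=> /orP[h|h].
    by rewrite tent_left// ltW.
  by rewrite tent_right// ltW.
have bi h : L1 (ball x e) h -> L1 (ball x e) (fun t => h t * tent x e t).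
  move=> hi; have := L1_tent x e0 mb hi; apply: eq_integrable => // t _.
  by rewrite /= mulrC.
have fxi : L1 (ball x e) (fun t => f t - f x).
  apply: L1B => //; have := L1Z (f x) mb ib; apply: eq_integrable => // t _.
  by rewrite /= mulr1.
rewrite bT -[X in _ - X]mulr1 -{1}I1 -RintegralZl//; last exact: bi.
rewrite -RintegralB//; last 2 first.
  by exact: bi.
  by apply: L1Z => //; exact: bi.
under eq_Rintegral do rewrite mul1r -mulrBl.
apply: le_trans (le_normr_Rintegral _ _) _ => //; first exact: (bi _ fxi).
apply: (@le_trans _ _ (\int[mu]_(t in ball x e) (2 / e * `|f t - f x|))).
  apply: le_Rintegral => //; first exact: (L1_norm (bi _ fxi)).
    by apply: L1Z => //; exact: (L1_norm fxi).
  by move=> t _; rewrite normrM mulrC ler_wpM2r// tent_bound.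
rewrite RintegralZl//; last exact: (L1_norm fxi).
have davgE : davg f x e = ((2 * e)^-1 * \int[mu]_(t in ball x e) `|f t - f x|)%:E.
  rewrite /davg /iavg lebesgue_measure_ball ?(ltW e0)//.
  have e20 : 0 < e *+ 2 by rewrite mulrn_wgt0.
  rewrite inver gt_eqF// mulr_natl EFinM; congr (_ * _)%E.
  rewrite -[LHS]fineK; first by [].
  by apply: integrable_fin_num => //; exact: (L1_norm fxi).
have : `|fine (davg f x e)| <= eps / 4 by [].
rewrite davgE /= ger0_norm; last first.
  by rewrite mulr_ge0 ?invr_ge0 ?mulr_ge0 ?(ltW e0)//; exact: Rintegral_ge0.
rewrite ler_pdivrMl ?mulr_gt0// => h.
have arith (I : R) : I <= 2 * e * (eps / 4) -> 2 * I <= eps * e by lra.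
by rewrite mulrAC ler_pdivrMr//; exact: arith.
Qed.

Lemma ramp_cvg g x b : x < b -> L1 `[x, b] g ->
  \int[mu]_(t in `[x, b]) (g t * ramp x e t) @[e --> 0^'+] -->
  \int[mu]_(t in `[x, b]) g t.
Proof.
move=> xb gi; apply/cvgrPdist_le => eps eps0.
have := parameterized_integral_cvg_left xb (L1_norm gi).
move/cvgrPdist_le/(_ _ eps0) => h.
have /nbhs_ballP[d /= d0 hd] := h.
have bx0 : 0 < b - x by rewrite subr_gt0.
apply: filterS3 (nbhs_right_gt 0) (nbhs_right_lt bx0) (nbhs_right_lt d0).
move=> e e0 eb ed; set G := \int[mu]_(t in _) g t.
have {hd} le_eps : \int[mu]_(t in `[x, x + e]) `|g t| <= eps.
  have := hd (x + e); rewrite sub0r normrN ger0_norm; last exact: Rintegral_ge0.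
  apply; rewrite ball_itv /= in_itv/=; lra.
have xeb : x + e <= b by lra.
have mr : measurable_fun `[x, b] (ramp x e).
  apply: measurable_funS measurableT _ _ => //.
  by apply: continuous_measurable_fun; exact: continuous_ramp.
have gri : L1 `[x, b] (fun t => g t * ramp x e t).
  apply: (@L1_le _ _ _ (fun t => `|g t|)) => //; last exact: L1_norm.
    by apply: measurable_funM => //; exact: L1_measurable.
  move=> t _; rewrite normrM ler_piMr// ger0_norm ?ramp_ge0//.
  exact: ramp_le1.
rewrite /G -RintegralB//.
have ki : L1 `[x, x + e] (fun t => g t - g t * ramp x e t).
  by apply: (@L1_itv _ _ x b) => //; exact: L1B.
rewrite (@Rintegral_support _ `[x, x + e]); last 2 first.
- by apply: subset_itvScc; rewrite bnd_simp.
- move=> t /=; rewrite !in_itv/= => /andP[-> _] /= /negP; rewrite -ltNge => h'.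
  by rewrite ramp_right ?ltW// mulr1 subrr.
apply: le_trans (le_normr_Rintegral _ _) _ => //.
apply: le_trans le_eps; apply: le_Rintegral => //.
- exact: (L1_norm ki).
- by apply: L1_norm; apply: L1_itv gi.
move=> t _; rewrite -{1}[g t]mulr1 -mulrBr normrM ler_piMr//.
rewrite ger0_norm ?subr_ge0 ?ramp_le1// lerBlDr lerDl.
exact: ramp_ge0.
Qed.

End LebesguePoints.

Section WeakDerivative.
Context {R : realType}.
Implicit Types (D : set R) (f g h : R -> R) (a b x y e : R).

(** Test with [ramp x e - ramp y e]: its derivative is the difference of two
    tents, which pick out [f x] and [f y] as [e] tends to [0], and the function
    itself tends to the indicator of [[x, y]].  The point [b] leaves room for the
    second ramp to come down inside [D]. *)
Lemma weak_derivative_increment D f g x y b : measurable D ->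
  x < y -> y < b -> `[x, b] `<=` D -> L1 D f -> L1 D g ->
  is_weak_derivative D f g -> lebesgue_pt (f \_ D) x -> lebesgue_pt (f \_ D) y ->
  f y - f x = \int[mu]_(t in `[x, y]) g t.
Proof.
move=> mD xy yb xbD fi gi fg fx fy.
have xb : x < b by exact: lt_trans yb.
have gxb : L1 `[x, b] g by apply: integrableS gi.
have gyb : L1 `[y, b] g by apply: L1_itv gxb => //; exact: ltW.
have fT : L1 setT (f \_ D) by exact: L1_patch.
have fE t : x <= t <= b -> (f \_ D) t = f t.
  by move=> tin; rewrite patchE mem_set//; apply: xbD; rewrite /= in_itv.
have lhs : \int[mu]_t ((f \_ D) t * tent x e t) -
           \int[mu]_t ((f \_ D) t * tent y e t)
    @[e --> 0^'+] --> f x - f y.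
  rewrite -(fE x); last by rewrite lexx ltW.
  rewrite -(fE y); last by rewrite !ltW.
  by apply: cvgB; exact: tent_cvg.
have rhs : - (\int[mu]_(t in `[x, b]) (g t * ramp x e t) -
    \int[mu]_(t in `[y, b]) (g t * ramp y e t)) @[e --> 0^'+] -->
    - (\int[mu]_(t in `[x, b]) g t - \int[mu]_(t in `[y, b]) g t).
  by apply: cvgN; apply: cvgB; exact: ramp_cvg.
have tent_mul z e : 0 < e -> L1 setT (fun t => (f \_ D) t * tent z e t).
  move=> e0; have := L1_tent z e0 measurableT fT; apply: eq_integrable => // t _.
  by rewrite /= mulrC.
have ramp_mul z e : 0 < e -> L1 `[x, b] (fun t => g t * ramp z e t).
  move=> e0; apply: (@L1_le _ _ _ (fun t => `|g t|)) => //; last exact: L1_norm.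
    apply: measurable_funM => //; first exact: L1_measurable.
    apply: measurable_funS measurableT _ _ => //.
    by apply: continuous_measurable_fun; exact: continuous_ramp.
  move=> t _; rewrite normrM ler_piMr// ger0_norm ?ramp_ge0//.
  exact: ramp_le1.
have : f x - f y = - (\int[mu]_(t in `[x, b]) g t - \int[mu]_(t in `[y, b]) g t).
  apply: (cvg_unique (@Rhausdorff R) lhs).
  apply: cvg_trans rhs; apply: near_eq_cvg.
  have by0 : 0 < b - y by rewrite subr_gt0.
  apply: filterS2 (nbhs_right_gt 0) (nbhs_right_lt by0).
  move=> e e0 eb; symmetry.
  pose phi t := ramp x e t - ramp y e t.
  have dphi (t : R) : is_derive t 1 phi (tent x e t - tent y e t).
    have h1 := is_derive_ramp x e t; have h2 := is_derive_ramp y e t.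
    exact: is_deriveB.
  have phi' t : derive1 phi t = tent x e t - tent y e t.
    by rewrite derive1E; have h1 := dphi t; rewrite derive_val.
  have phiC1 : C1_function phi.
    split; first by move=> t; case: (dphi t).
    move=> t; rewrite /continuous_at phi'.
    have -> : derive1 phi = fun t => tent x e t - tent y e t by exact/funext.
    by apply: cvgB; exact: continuous_tent.
  have phi0 t : ~ `[x, b]%classic t -> phi t = 0.
    rewrite /= in_itv/= => /negP; rewrite negb_and -!ltNge => /orP[tx|bt].
      by rewrite /phi !ramp_left ?subrr//; lra.
    by rewrite /phi !ramp_right ?subrr//; lra.
  have phicpt : compactly_supported_in D phi.
    by exists `[x, b]%classic; split => //; exact: segment_compact.
  have := fg phi phiC1 phicpt.
  rewrite Rintegral_patch; under eq_Rintegral do rewrite phi' mulrBr.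
  rewrite RintegralB//; [|exact: tent_mul..] => ->.
  congr (- _).
  have phi0' h t : D t -> ~ `[x, b]%classic t -> h t * phi t = 0.
    by move=> _ /phi0 ->; rewrite mulr0.
  rewrite (Rintegral_support xbD (phi0' g)).
  rewrite -(@Rintegral_support _ `[x, b]%classic `[y, b]%classic
    (fun t => g t * ramp y e t)); last 2 first.
  - by apply: subset_itvScc; rewrite bnd_simp// ltW.
  - move=> t /=; rewrite !in_itv/= => /andP[_ ->]; rewrite andbT => /negP.
    by rewrite -ltNge => ty; rewrite ramp_left ?mulr0// ltW.
  rewrite -RintegralB//; [|exact: ramp_mul..].
  by apply: eq_Rintegral => t _; rewrite mulrBr.
move=> h; rewrite -[LHS]opprB h opprK.
have := @Rintegral_increment _ g x b y b (ltW xy) (ltW yb) (lexx b) gxb.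
by move=> <-; rewrite opprB addrC subrK.
Qed.

End WeakDerivative.

Section AlmostEverywhere.
Context {R : realType}.
Implicit Types (D K : set R) (f g h : R -> R) (a b x y e : R).

Lemma aeS (P Q : R -> Prop) : (forall x, P x -> Q x) ->
  {ae mu, forall x, P x} -> {ae mu, forall x, Q x}.
Proof. by move=> PQ; apply: filterS PQ; exact: (ae_filter_ringOfSetsType mu). Qed.

Lemma aeS2 (P Q S : R -> Prop) : (forall x, P x -> Q x -> S x) ->
  {ae mu, forall x, P x} -> {ae mu, forall x, Q x} -> {ae mu, forall x, S x}.
Proof. by move=> h; apply: filterS2 h; exact: (ae_filter_ringOfSetsType mu). Qed.

Lemma aeS3 (P Q S T : R -> Prop) : (forall x, P x -> Q x -> S x -> T x) ->
  {ae mu, forall x, P x} -> {ae mu, forall x, Q x} -> {ae mu, forall x, S x} ->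
  {ae mu, forall x, T x}.
Proof. by move=> h; apply: filterS3 h; exact: (ae_filter_ringOfSetsType mu). Qed.

Lemma ae_dense (P : R -> Prop) a b :
  {ae mu, forall x, a < x < b -> P x} -> a < b ->
  exists2 x, a < x < b & P x.
Proof.
move=> [N [mN N0 PN]] ab; apply: contrapT => noP.
have : (mu `]a, b[ <= mu N)%E.
  apply: le_measure; rewrite ?inE// => x /=; rewrite in_itv/= => xab.
  by apply: PN => /= h; apply: noP; exists x => //; exact: h.
rewrite [X in (X <= _)%E -> _](_ : _ = (b - a)%:E); last first.
  by rewrite /= lebesgue_measure_itv/= lte_fin ab -EFinD.
by rewrite N0 lee_fin leNgt subr_gt0 ab.
Qed.

(** A set of full measure meets every open interval, so it is dense. *)
Lemma ae_continuous_eq0 (q : R -> R) a b : a < b -> {within `[a, b], continuous q} ->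
  {ae mu, forall x, a < x < b -> q x = 0} -> forall x, a <= x <= b -> q x = 0.
Proof.
move=> ab cq q0 x xab; apply: contrapT => /eqP qx.
have qx0 : 0 < `|q x| by rewrite normr_gt0.
have /subspace_continuousP/(_ x) := cq; rewrite /= in_itv/= => /(_ xab).
move=> /cvgrPdist_lt/(_ _ qx0); rewrite near_withinE => /nbhs_ballP[d /= d0 hd].
have [| |y /andP[y1 y2]] := @ae_dense (fun x => q x = 0)
  (Num.max a (x - d)) (Num.min b (x + d)).
- apply: aeS q0 => y hy /andP[]; rewrite gt_max lt_min => /andP[ay _] /andP[yb _].
  by apply: hy; rewrite ay yb.
- rewrite gt_max !lt_min ab; move/andP: xab => [? ?].
  by apply/andP; split; apply/andP; split; lra.
move: y1 y2; rewrite gt_max lt_min => /andP[ay dy] /andP[yb yd] qy.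
have ayb : `[a, b]%classic y by rewrite /= in_itv/= !ltW.
have yball : ball x d y by rewrite ball_itv /= in_itv/= dy yd.
by have := hd y yball ayb; rewrite /from_subspace qy subr0 ltxx.
Qed.

Lemma C1_bounded D (phi : R -> R) :
  C1_function phi -> compactly_supported_in D phi ->
  exists M, forall t, `|phi t| <= M.
Proof.
move=> [dphi _] [K [cK KD phi0]].
have cphi : continuous phi.
  by move=> t; apply/differentiable_continuous/derivable1_diffP.
have [M [_ MP]] := compact_bounded (continuous_compact (continuous_subspaceT cphi) cK).
exists (Num.max 0 (M + 1)) => t; rewrite le_max.
have [Kt|Kt] := pselect (K t); last by rewrite phi0// normr0 lexx.
by rewrite (MP (M + 1)) ?orbT ?ltrDl//; exists t.
Qed.

Lemma C1_measurable D (phi : R -> R) : measurable D -> C1_function phi ->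
  measurable_fun D phi /\ measurable_fun D (derive1 phi).
Proof.
move=> mD [dphi cphi']; split.
  apply: measurable_funS measurableT _ _ => //; apply: continuous_measurable_fun.
  by move=> t; apply/differentiable_continuous/derivable1_diffP.
by apply: measurable_funS measurableT _ _ => //; exact: continuous_measurable_fun.
Qed.

End AlmostEverywhere.

Section WeakDerivativeTheory.
Context {R : realType}.
Implicit Types (D K : set R) (f g h : R -> R) (a b x y e : R).

Lemma lebesgue_pt_ae D f : measurable D -> L1 D f ->
  {ae mu, forall x, lebesgue_pt (f \_ D) x}.
Proof. by move=> mD fi; apply: lebesgue_differentiation; exact: integrable_locally. Qed.

(** By [weak_derivative_increment] with [f = 0], [g] integrates to [0] over every
    interval in [D]; at a Lebesgue point [g] is the derivative of its primitive,
    hence [0]. *)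
Lemma weak_derivative_of_0 D g : open D -> L1 D g ->
  is_weak_derivative D (cst 0) g -> {ae mu, forall x, D x -> g x = 0}.
Proof.
move=> oD gi g0; have mD : measurable D by exact: open_measurable.
apply: aeS (lebesgue_pt_ae mD gi) => x gx Dx.
have /nbhs_ballP[d /= d0 xdD] := oD _ Dx.
have i0 : L1 D (cst 0) by exact: integrable0.
have lp0 y : lebesgue_pt ((cst 0 : R -> R) \_ D) y.
  have -> : (cst 0 : R -> R) \_ D = cst 0.
    by apply/funext => t; rewrite patchE; case: ifP.
  apply: (@continuous_lebesgue_pt _ _ _ setT) => //; first by split => //; exact: openT.
  exact: cst_continuous.
pose a := x - d / 2; pose F y := \int[mu]_(t in `[a, y]) (g \_ D) t.
have sub y z : a <= y -> z < x + d -> `[y, z] `<=` D.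
  rewrite /a => ay zb t /=; rewrite in_itv/= => /andP[yt tz].
  by apply: xdD; rewrite ball_itv /= in_itv/=; apply/andP; split; lra.
have F0 y : a < y < x + d / 2 -> F y = 0.
  move=> /andP[ay yb].
  have -> : F y = \int[mu]_(t in `[a, y]) g t.
    apply: eq_Rintegral => t /set_mem ty; rewrite patchE mem_set//.
    by apply: (sub a y) => //; lra.
  rewrite -(@weak_derivative_increment _ D (cst 0) g a y (x + d / 2))// ?subrr//.
  by apply: sub => //; lra.
have gT : L1 `[a, x + d / 2] (g \_ D).
  by apply: integrableS (L1_patch mD gi).
have xu : x < x + d / 2 by lra.
have [|_ Fx] := FTC1_lebesgue_pt xu gT _ gx; first by rewrite lte_fin /a; lra.
have <- : (g \_ D) x = g x by rewrite patchE mem_set.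
rewrite -Fx derive1E (@near_eq_derive _ _ _ _ (cst 0)) ?derive_cst//.
have : x \in `](x - d / 2), (x + d / 2)[ by rewrite in_itv/=; apply/andP; split; lra.
move/near_in_itvoo; apply: filterS => y; rewrite in_itv/=.
exact: F0.
Qed.

Lemma weak_derivative_unique D f g h : open D -> L1 D f -> L1 D g -> L1 D h ->
  is_weak_derivative D f g -> is_weak_derivative D f h ->
  {ae mu, forall x, D x -> g x = h x}.
Proof.
move=> oD fi gi hi fg fh; have mD : measurable D by exact: open_measurable.
have : is_weak_derivative D (cst 0) (g \- h).
  move=> phi phiC1 phicpt.
  have [M phiM] := C1_bounded phiC1 phicpt.
  have [mphi _] := C1_measurable mD phiC1.
  have mulphi k : L1 D k -> L1 D (fun t => k t * phi t).
    move=> ki; have := L1_bounded_mul mD mphi (fun t _ => phiM t) ki.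
    by apply: eq_integrable => // t _; rewrite /= mulrC.
  under eq_Rintegral do rewrite mul0r.
  under [in RHS]eq_Rintegral do rewrite mulrBl.
  rewrite Rintegral_cst// mul0r RintegralB//; [|exact: mulphi..].
  have := fg _ phiC1 phicpt; rewrite (fh _ phiC1 phicpt) => /oppr_inj ->.
  by rewrite subrr oppr0.
move=> /(weak_derivative_of_0 oD (L1B mD gi hi)); apply: aeS => x gh Dx.
by apply/eqP; rewrite -subr_eq0; apply/eqP; exact: gh.
Qed.

(** The absolutely continuous representative: the constant is adjusted at one
    Lebesgue point of [f], and almost every point is one. *)
Lemma weak_derivative_primitive D f g a b : open D -> L1 D f -> L1 D g ->
  is_weak_derivative D f g -> a < b -> `]a, b[ `<=` D ->
  exists c, {ae mu, forall x, a < x < b ->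
    f x = c + \int[mu]_(t in `[a, x]) (g \_ D) t}.
Proof.
move=> oD fi gi fg ab abD; have mD : measurable D by exact: open_measurable.
have lp := lebesgue_pt_ae mD fi.
have [x0 /andP[ax0 x0b] fx0] : exists2 x, a < x < b & lebesgue_pt (f \_ D) x.
  by apply: ae_dense ab; apply: aeS lp.
have gT : L1 `[a, b] (g \_ D) by apply: integrableS (L1_patch mD gi).
have incr x y : a < x -> x < y -> y < b -> lebesgue_pt (f \_ D) x ->
    lebesgue_pt (f \_ D) y -> f y - f x =
    \int[mu]_(t in `[a, y]) (g \_ D) t - \int[mu]_(t in `[a, x]) (g \_ D) t.
  move=> ax xy yb fx fy.
  have sub : `[x, (y + b) / 2] `<=` D.
    move=> t /=; rewrite in_itv/= => /andP[xt tb]; apply: abD.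
    by rewrite /= in_itv/=; apply/andP; split; lra.
  rewrite (@weak_derivative_increment _ D f g x y ((y + b) / 2))//; last lra.
  rewrite (@Rintegral_increment _ _ a b) ?ltW//.
  apply: eq_Rintegral => t /set_mem /=; rewrite in_itv/= => /andP[xt ty].
  rewrite patchE mem_set//; apply: sub.
  by rewrite /= in_itv/=; apply/andP; split; lra.
exists (f x0 - \int[mu]_(t in `[a, x0]) (g \_ D) t).
apply: aeS lp => x fx /andP[ax xb].
have [xx0|x0x|->] := ltgtP x x0; last by rewrite subrK.
  by have := incr x x0 ax xx0 x0b fx fx0; lra.
by have := incr x0 x ax0 x0x xb fx0 fx; lra.
Qed.

End WeakDerivativeTheory.

(** * The twist as angular speed *)

Section Lifting.
Context {R : realType}.
Implicit Types (D : set R) (f g h : R -> R) (u : R -> R * R) (a b x y : R).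

Lemma dom_measure_lty D : measurable D -> D `<=` dom -> (mu D < +oo)%E.
Proof.
move=> mD Ddom; apply: (@le_lt_trans _ _ (mu (dom : set R))).
  by apply: le_measure; rewrite ?inE//; exact: measurable_itv.
rewrite [X in (X < _)%E](_ : _ = 1%:E) ?ltry//.
by rewrite /dom /= lebesgue_measure_itv/= lte_fin ltr01 -EFinD subr0.
Qed.

Lemma L1_cst D (c : R) : measurable D -> D `<=` dom -> L1 D (fun=> c).
Proof.
move=> mD Ddom; apply: measurable_bounded_integrable => //.
  exact: dom_measure_lty.
by exists `|c|; split => // M cM t _; rewrite ltW.
Qed.

Lemma inL2_L1 D f : measurable D -> D `<=` dom -> inL2 D f -> L1 D f.
Proof.
move=> mD Ddom [mf f2]; apply: (@L1_le _ _ _ (fun t => 1 + f t ^+ 2)) => //.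
  move=> t _; rewrite ler_norml; apply/andP; split; nra.
by apply: L1D => //; exact: L1_cst.
Qed.

Lemma inL2_mul_L1 D f g : measurable D -> inL2 D f -> inL2 D g ->
  L1 D (fun t => f t * g t).
Proof.
move=> mD [mf f2] [mg g2]; apply: (@L1_le _ _ _ (fun t => f t ^+ 2 + g t ^+ 2)) => //.
- exact: measurable_funM.
- move=> t _; rewrite ler_norml; apply/andP; split; nra.
- exact: L1D.
Qed.

Lemma weak_derivativeP D f : inH1 D f ->
  inL2 D (weak_derivative D f) /\ is_weak_derivative D f (weak_derivative D f).
Proof. by move=> [_ /getPex]. Qed.

Lemma twist_L1 D u : measurable D -> inH1_S1 D u -> L1 D (twist D u).
Proof.
move=> mD [u1 u2 _].
have [g1 _] := weak_derivativeP u1; have [g2 _] := weak_derivativeP u2.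
have [[f1 _] [f2 _]] := (u1, u2).
by apply: L1B => //; exact: inL2_mul_L1.
Qed.

Lemma within_continuous_primitive g a b (c : R) : a <= b -> L1 `[a, b] g ->
  {within `[a, b], continuous (fun x => c + \int[mu]_(t in `[a, x]) g t)}.
Proof.
move=> ab gi x; apply: cvgD; first exact: cvg_cst.
exact: (parameterized_integral_continuous ab gi).
Qed.

Lemma Rintegral_ae_eq D f g : measurable D ->
  measurable_fun D f -> measurable_fun D g ->
  {ae mu, forall t, D t -> f t = g t} ->
  \int[mu]_(t in D) f t = \int[mu]_(t in D) g t.
Proof.
move=> mD mf mg fg; congr fine; apply: ae_eq_integral => //.
- exact/measurable_EFinP.
- exact/measurable_EFinP.
- by apply: aeS fg => t h Dt /=; rewrite h.
Qed.

Lemma Rintegral_itv_ae_eq f g a b : L1 `[a, b] f -> L1 `[a, b] g ->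
  {ae mu, forall t, a < t < b -> f t = g t} ->
  \int[mu]_(t in `[a, b]) f t = \int[mu]_(t in `[a, b]) g t.
Proof.
move=> fi gi fg.
have open_closed h : L1 `[a, b] h ->
    \int[mu]_(t in `[a, b]) h t = \int[mu]_(t in `]a, b[) h t.
  move=> hi; rewrite Rintegral_itv_bndo_bndc ?Rintegral_itv_obnd_cbnd//.
    by apply: integrableS hi => //; exact: subset_itv_oc_cc.
  by apply: integrableS hi => //; exact: subset_itv_oo_cc.
rewrite !open_closed//; apply: Rintegral_ae_eq => //.
- by apply: L1_measurable; apply: integrableS fi => //; exact: subset_itv_oo_cc.
- by apply: L1_measurable; apply: integrableS gi => //; exact: subset_itv_oo_cc.
Qed.

(** The weak derivatives of the two components give continuous representatives
    [V1], [V2]; the constraint [|u| = 1], valid almost everywhere, passes to them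
    everywhere by continuity, and [angle_lifting] applies. *)
Lemma twist_lifting D u a b : open D -> D `<=` dom -> inH1_S1 D u ->
  a < b -> `]a, b[ `<=` D ->
  exists c, {ae mu, forall x, a < x < b ->
    u x = expi (c + \int[mu]_(t in `[a, x]) (twist D u \_ D) t)}.
Proof.
move=> oD Ddom uD ab abD; have mD : measurable D by exact: open_measurable.
have tw := twist_L1 mD uD.
have [H1 H2 uS] := uD.
have [/(inL2_L1 mD Ddom) g1i w1] := weak_derivativeP H1.
have [/(inL2_L1 mD Ddom) g2i w2] := weak_derivativeP H2.
set g1 := weak_derivative D _ in g1i w1; set g2 := weak_derivative D _ in g2i w2.
have [/(inL2_L1 mD Ddom) u1i _] := H1.
have [/(inL2_L1 mD Ddom) u2i _] := H2.
have [c1 u1E] := weak_derivative_primitive oD u1i g1i w1 ab abD.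
have [c2 u2E] := weak_derivative_primitive oD u2i g2i w2 ab abD.
have restr g : L1 D g -> L1 `[a, b] (g \_ D).
  by move=> gi; apply: integrableS (L1_patch mD gi).
pose V1 x := c1 + \int[mu]_(t in `[a, x]) (g1 \_ D) t.
pose V2 x := c2 + \int[mu]_(t in `[a, x]) (g2 \_ D) t.
have V1a : V1 a = c1 by rewrite /V1 set_itv1 Rintegral_set1 addr0.
have V2a : V2 a = c2 by rewrite /V2 set_itv1 Rintegral_set1 addr0.
have cV1 : {within `[a, b], continuous V1}.
  by apply: within_continuous_primitive; [exact: ltW|exact: restr].
have cV2 : {within `[a, b], continuous V2}.
  by apply: within_continuous_primitive; [exact: ltW|exact: restr].
have in_D x : a < x < b -> D x by move=> xab; apply: abD; rewrite /= in_itv.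
have V1V2 x : a <= x <= b -> V1 x ^+ 2 + V2 x ^+ 2 = 1.
  move=> xab; apply/eqP; rewrite -subr_eq0; apply/eqP.
  apply: (@ae_continuous_eq0 _ (fun x => V1 x * V1 x + V2 x * V2 x - 1) a b) => //.
    move=> y; apply: cvgB; last exact: cvg_cst.
    apply: cvgD; apply: cvgM; [exact: cV1|exact: cV1|exact: cV2|exact: cV2].
  apply: aeS3 u1E u2E uS => y e1 e2 e3 yab.
  by rewrite /V1 /V2 -e1// -e2// -!expr2 e3 ?subrr//; exact: in_D.
have V1E x : a <= x <= b -> V1 x = V1 a + \int[mu]_(t in `[a, x]) (g1 \_ D) t.
  by rewrite V1a.
have V2E x : a <= x <= b -> V2 x = V2 a + \int[mu]_(t in `[a, x]) (g2 \_ D) t.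
  by rewrite V2a.
have [hi [c cE]] := angle_lifting (ltW ab) (restr _ g1i) (restr _ g2i) V1E V2E V1V2.
exists c; apply: aeS2 (u1E) (u2E) => x e1 e2 xab.
have := cE x; have /andP[ax xb] := xab; rewrite !ltW// => /(_ isT).
rewrite /V1 -e1// /V2 -e2// -surjective_pairing => ->; congr (expi (c + _)).
apply: Rintegral_itv_ae_eq.
- by apply: L1_itv hi => //; exact: ltW.
- by apply: L1_itv (restr _ tw) => //; exact: ltW.
apply: aeS2 u1E u2E => t e1t e2t /andP[at' tx].
have tab : a < t < b by rewrite at' (lt_trans tx).
have tD := in_D t tab.
by rewrite /V1 /V2 -e1t// -e2t// !patchE !mem_set.
Qed.

End Lifting.

(** * One-sided limits and traces *)

Section OneSidedLimits.
Context {R : realType}.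
Implicit Types (w v : R -> R * R) (a b x : R) (l : R * R).

(** [F] restricted to a set that meets all its members is still a proper filter. *)
Lemma ae_limit_unique (F : set_system R) (w v : R -> R * R) (A : set R) l k :
  Filter F -> (forall B, F B -> exists2 x, B x & A x) ->
  (forall x, A x -> w x = v x) -> w @ F --> l -> v @ F --> k -> l = k.
Proof.
move=> FF FA wv wl vk.
have PF : ProperFilter (within A F).
  by split; [move=> /FA [x /[apply]]|exact: within_filter].
have wl' : w @ within A F --> l.
  by apply: cvg_trans wl; apply: cvg_app; exact: cvg_within.
have vk' : v @ within A F --> k.
  by apply: cvg_trans vk; apply: cvg_app; exact: cvg_within.
apply: (cvg_unique (@norm_hausdorff R _) wl').
apply: cvg_trans vk'; apply: near_eq_cvg; rewrite near_withinE.
by apply: nearW => x /wv.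
Qed.

Lemma at_right_dense (P : R -> Prop) a b : a < b ->
  {ae mu, forall x, a < x < b -> P x} ->
  forall B, a^'+ B -> exists2 x, B x & P x /\ a < x < b.
Proof.
move=> ab aP B aB.
have /nbhs_ballP[d /= d0 hd] : nbhs a (fun x => a < x -> B x) := aB.
have [||x /andP[ax]] := @ae_dense _ (fun x => P x /\ a < x < b) a (Num.min b (a + d)).
- apply: aeS aP => x aP /andP[ax]; rewrite lt_min => /andP[xb _].
  by split; [apply: aP|]; rewrite ax xb.
- by rewrite lt_min ab ltrDl.
rewrite lt_min => /andP[xb xd] Px; exists x => //.
by apply: hd => //; rewrite ball_itv /= in_itv/=; apply/andP; split; lra.
Qed.

Lemma at_left_dense (P : R -> Prop) a b : a < b ->
  {ae mu, forall x, a < x < b -> P x} ->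
  forall B, b^'- B -> exists2 x, B x & P x /\ a < x < b.
Proof.
move=> ab aP B bB.
have /nbhs_ballP[d /= d0 hd] : nbhs b (fun x => x < b -> B x) := bB.
have [||x /andP[+ xb]] := @ae_dense _ (fun x => P x /\ a < x < b) (Num.max a (b - d)) b.
- apply: aeS aP => x aP /andP[+ xb]; rewrite gt_max => /andP[ax _].
  by split; [apply: aP|]; rewrite ax xb.
- by rewrite gt_max ab ltrBlDr ltrDl.
rewrite gt_max => /andP[ax xd] Px; exists x => //.
by apply: hd => //; rewrite ball_itv /= in_itv/=; apply/andP; split; lra.
Qed.

Lemma ae_at_right_unique w v a b l k : a < b ->
  {ae mu, forall x, a < x < b -> w x = v x} ->
  w @ a^'+ --> l -> v @ a^'+ --> k -> l = k.
Proof.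
move=> ab wv; apply: (@ae_limit_unique _ _ _ (fun x => w x = v x /\ a < x < b)).
  exact: at_right_dense.
by move=> x [].
Qed.

Lemma ae_at_left_unique w v a b l k : a < b ->
  {ae mu, forall x, a < x < b -> w x = v x} ->
  w @ b^'- --> l -> v @ b^'- --> k -> l = k.
Proof.
move=> ab wv; apply: (@ae_limit_unique _ _ _ (fun x => w x = v x /\ a < x < b)).
  exact: at_left_dense.
by move=> x [].
Qed.

Lemma expi_cvg (F : set_system R) (f : R -> R) (l : R) : Filter F ->
  f @ F --> l -> (fun x => expi (f x)) @ F --> expi l.
Proof.
move=> FF fl.
have h1 : cos (f x) @[x --> F] --> cos l.
  by apply: continuous_cvg => //; exact: continuous_cos.
have h2 : sin (f x) @[x --> F] --> sin l.
  by apply: continuous_cvg => //; exact: continuous_sin.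
exact: (cvg_pair h1 h2).
Qed.

Lemma has_trace0_unique u w l k : ae_eq_dom u w -> has_trace 0^'+ u l ->
  w @ 0^'+ --> k -> l = k.
Proof.
move=> uw [v [vu vl]]; apply: ae_at_right_unique ltr01 _ vl.
by apply: aeS2 uw vu => x e1 e2 xin; rewrite e2 ?e1// /dom /= in_itv.
Qed.

Lemma has_trace1_unique u w l k : ae_eq_dom u w -> has_trace 1^'- u l ->
  w @ 1^'- --> k -> l = k.
Proof.
move=> uw [v [vu vl]]; apply: ae_at_left_unique ltr01 _ vl.
by apply: aeS2 uw vu => x e1 e2 xin; rewrite e2 ?e1// /dom /= in_itv.
Qed.

End OneSidedLimits.

(** * Weak derivatives of piecewise C^1 functions *)

Section Piecewise.
Context {R : realType}.
Implicit Types (D J : set R) (f g h : R -> R) (u : R -> R * R) (a b c d p x y : R).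

Lemma open_dom_setD J : finite_set J -> open (dom `\` J).
Proof.
move=> fJ; apply: openI; first exact: interval_open.
rewrite openC; have := hausdorff_accessible (@Rhausdorff R).
by rewrite accessible_finite_set_closed; exact.
Qed.

Lemma measurable_dom_setD J : finite_set J -> measurable (dom `\` J).
Proof. by move=> fJ; apply: open_measurable; exact: open_dom_setD. Qed.

Lemma dom_setDE J : J `<=` `[0, 1] ->
  dom `\` J = `[0, 1] `\` (([set 0] `|` [set 1]) `|` J).
Proof.
move=> J01; apply/seteqP; split=> x; rewrite /dom /= !in_itv/=.
  move=> [/andP[x0 x1] Jx]; split; first by rewrite !ltW.
  by move=> [[|]|]// xE; move: x0 x1; rewrite xE ltxx.
move=> [/andP[x0 x1] NJ]; split; last by move=> Jx; apply: NJ; right.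
apply/andP; split; rewrite lt_neqAle ?x0 ?x1 andbT; apply/eqP => xE.
  by apply: NJ; left; left.
by apply: NJ; left; right.
Qed.

Lemma finite_measure0 J : finite_set J -> mu J = 0 :> \bar R.
Proof.
by move=> fJ; apply: countable_lebesgue_measure0; exact: finite_set_countable.
Qed.

Lemma Rintegral_dom_setD J h : finite_set J -> J `<=` `[0, 1] -> L1 `[0, 1] h ->
  \int[mu]_(t in dom `\` J) h t = \int[mu]_(t in `[0, 1]) h t.
Proof.
move=> fJ J01 hi; rewrite dom_setDE//; congr fine; symmetry.
have fN : finite_set (([set 0] `|` [set 1]) `|` J) by rewrite !finite_setU.
apply: negligible_integral => //; last exact: finite_measure0.
by apply: countable_measurable => //; exact: finite_set_countable.
Qed.

Lemma C1_integration_by_parts f (df phi : R -> R) a b : a < b ->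
  (forall x : R, is_derive x 1 f (df x)) -> continuous df -> C1_function phi ->
  \int[mu]_(x in `[a, b]) (f x * derive1 phi x) =
  f b * phi b - f a * phi a - \int[mu]_(x in `[a, b]) (df x * phi x).
Proof.
move=> ab fdf cdf [dphi cdphi].
have LR (F : R -> R) :
    (forall x, derivable F x 1) -> derivable_oo_LRcontinuous F a b.
  move=> dF; have cF x : {for x, continuous F}.
    by apply/differentiable_continuous/derivable1_diffP.
  split; first by move=> *; exact: dF.
    by apply: cvg_at_right_filter; exact: cF.
  by apply: cvg_at_left_filter; exact: cF.
apply: (@Rintegration_by_parts _ f phi df (derive1 phi) a b ab).
- exact: continuous_subspaceT.
- by apply: (LR f) => x; case: (fdf x).
- by move=> x _; rewrite derive1E; have h := fdf x; rewrite derive_val.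
- exact: continuous_subspaceT.
- exact: (LR _ dphi).
- by move=> x _.
Qed.

Definition piecewise p f1 f2 : R -> R := fun x => if x < p then f1 x else f2 x.

Lemma measurable_piecewise p f1 f2 D :
  measurable D -> continuous f1 -> continuous f2 ->
  measurable_fun D (piecewise p f1 f2).
Proof.
move=> mD c1 c2; apply: measurable_funS measurableT _ _ => //.
apply: measurable_fun_ifT.
- exact: measurable_fun_ltr.
- exact: continuous_measurable_fun.
- exact: continuous_measurable_fun.
Qed.

(** Integrate by parts on [[0, p]] and on [[p, 1]].  The test function vanishes
    at [0] and [1], which lie outside the domain; the two boundary terms at [p]
    cancel, either because the test function also vanishes at [p], or because
    there is no discontinuity. *)
Lemma weak_derivative_piecewise J p f1 f2 (df1 df2 : R -> R) (M : R) :
  finite_set J -> J `<=` `[0, 1] ->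
  0 < p < 1 ->
  (forall x : R, is_derive x 1 f1 (df1 x)) -> continuous df1 ->
  (forall x : R, is_derive x 1 f2 (df2 x)) -> continuous df2 ->
  (forall x, `|f1 x| <= M /\ `|f2 x| <= M) ->
  (forall x, `|df1 x| <= M /\ `|df2 x| <= M) ->
  J p \/ f1 p = f2 p ->
  is_weak_derivative (dom `\` J) (piecewise p f1 f2) (piecewise p df1 df2).
Proof.
move=> fJ J01 /andP[p0 p1] d1 cd1 d2 cd2 fM dfM jump phi phiC1 phicpt.
have cont (f df : R -> R) : (forall x : R, is_derive x 1 f (df x)) -> continuous f.
  by move=> fdf x; apply/differentiable_continuous/derivable1_diffP; case: (fdf x).
have [N phiN] := C1_bounded phiC1 phicpt.
have [mphi mphi'] := C1_measurable (measurable_itv `[0, 1]) phiC1.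
have cphi : continuous phi.
  by move=> t; apply/differentiable_continuous/derivable1_diffP; case: phiC1.
have iphi : L1 `[0, 1] phi.
  apply: continuous_compact_integrable; first exact: segment_compact.
  exact: continuous_subspaceT.
have iphi' : L1 `[0, 1] (derive1 phi).
  apply: continuous_compact_integrable; first exact: segment_compact.
  by apply: continuous_subspaceT; case: phiC1.
have i1 : L1 `[0, 1] (fun x => piecewise p f1 f2 x * derive1 phi x).
  apply: (@L1_bounded_mul _ _ _ _ M) => //.
    apply: measurable_piecewise => //; [exact: cont d1|exact: cont d2].
  by move=> x _; rewrite /piecewise; case: ifP; have [] := fM x.
have i2 : L1 `[0, 1] (fun x => piecewise p df1 df2 x * phi x).
  apply: (@L1_bounded_mul _ _ _ _ M) => //.
    exact: measurable_piecewise.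
  by move=> x _; rewrite /piecewise; case: ifP; have [] := dfM x.
have phi0 x : ~ (dom `\` J) x -> phi x = 0.
  by case: phicpt => K [_ KD hK] Dx; apply: hK => /KD.
have phi_0 : phi 0 = 0 by apply: phi0 => -[]; rewrite /dom /= in_itv/= ltxx.
have phi_1 : phi 1 = 0 by apply: phi0 => -[]; rewrite /dom /= in_itv/= ltxx andbF.
rewrite !Rintegral_dom_setD//.
have split01 (h : R -> R) : L1 `[0, 1] h -> \int[mu]_(t in `[0, 1]) h t =
    \int[mu]_(t in `[0, p]) h t + \int[mu]_(t in `[p, 1]) h t.
  move=> hi; have := Rintegral_increment (ltW p0) (ltW p1) (lexx 1) hi.
  by move=> <-; rewrite addrC subrK.
have piece_left (g1 g2 k : R -> R) :
    L1 `[0, 1] (fun x => piecewise p g1 g2 x * k x) ->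
    L1 `[0, 1] (fun x => g1 x * k x) ->
    \int[mu]_(t in `[0, p]) (piecewise p g1 g2 t * k t) =
    \int[mu]_(t in `[0, p]) (g1 t * k t).
  move=> i1' i2'; apply: Rintegral_itv_ae_eq.
  - by apply: L1_itv i1' => //; exact: ltW.
  - by apply: L1_itv i2' => //; exact: ltW.
  - by apply: aeW => t /andP[_ tp]; rewrite /piecewise tp.
have piece_right (g1 g2 k : R -> R) :
    \int[mu]_(t in `[p, 1]) (piecewise p g1 g2 t * k t) =
    \int[mu]_(t in `[p, 1]) (g2 t * k t).
  apply: eq_Rintegral => t /set_mem /=; rewrite in_itv/= => /andP[pt _].
  by rewrite /piecewise ltNge pt.
have bmul (g k : R -> R) : continuous g -> (forall x, `|g x| <= M) ->
    L1 `[0, 1] k -> L1 `[0, 1] (fun x => g x * k x).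
  move=> cg gM ki; apply: (L1_bounded_mul (M := M)) => //.
  by apply: measurable_funS measurableT _ _ => //; exact: continuous_measurable_fun.
rewrite !split01// !piece_right !piece_left//; last 2 first.
- by apply: bmul => // x; have [] := dfM x.
- by apply: bmul => //; [exact: cont d1|move=> x; have [] := fM x].
rewrite (C1_integration_by_parts p0 d1)// (C1_integration_by_parts p1 d2)//.
rewrite phi_0 phi_1 !mulr0.
have : f1 p * phi p = f2 p * phi p.
  case: jump => [Jp|->//]; rewrite phi0 ?mulr0//.
  by move=> [_].
lra.
Qed.

End Piecewise.

(** * Phases with one jump *)

Section PhaseJump.
Context {R : realType}.
Implicit Types (D J : set R) (f g h : R -> R) (u : R -> R * R) (a b c d p x y : R).

(** Every minimizer has this form; [d1 = d2] gives a function without interior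
    jump, which may still miss the boundary values. *)
Definition phase_jump c d1 d2 p : R -> R * R :=
  fun x => expi (c * x + (if x < p then d1 else d2)).

Lemma is_derive_cos_affine c d x :
  is_derive x 1 (fun x => cos (c * x + d)) (- c * sin (c * x + d)).
Proof.
have h : is_derive x 1 (fun x => c * x + d) c.
  by apply: is_derive_eq; rewrite /GRing.scale/= mulr1 addr0.
have := @is_derive1_comp _ cos _ x _ _ (is_derive_cos _) h.
by rewrite mulNr [sin _ * c]mulrC -mulNr.
Qed.

Lemma is_derive_sin_affine c d x :
  is_derive x 1 (fun x => sin (c * x + d)) (c * cos (c * x + d)).
Proof.
have h : is_derive x 1 (fun x => c * x + d) c.
  by apply: is_derive_eq; rewrite /GRing.scale/= mulr1 addr0.
have := @is_derive1_comp _ sin _ x _ _ (is_derive_sin _) h.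
by rewrite mulrC.
Qed.

Lemma continuous_affine c d : continuous (fun x => c * x + d).
Proof.
move=> x; apply: cvgD; last exact: cvg_cst.
by apply: cvgMr; exact: cvg_id.
Qed.

Lemma continuous_cos_affine c d : continuous (fun x => cos (c * x + d)).
Proof.
by move=> x; apply: continuous_comp; [exact: continuous_affine|exact: continuous_cos].
Qed.

Lemma continuous_sin_affine c d : continuous (fun x => sin (c * x + d)).
Proof.
by move=> x; apply: continuous_comp; [exact: continuous_affine|exact: continuous_sin].
Qed.

Lemma inL2_bounded D f (M : R) : measurable D -> D `<=` dom -> measurable_fun D f ->
  (forall x, `|f x| <= M) -> inL2 D f.
Proof.
move=> mD Ddom mf fM; split => //.
apply: (@L1_le _ _ _ (fun=> M ^+ 2)) => //; last exact: L1_cst.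
  exact: measurable_funX.
by move=> x _; rewrite normrX lerXn2r ?nnegrE// (le_trans _ (fM x)).
Qed.

Lemma phase_jump1 c d1 d2 p x : (phase_jump c d1 d2 p x).1 =
  piecewise p (fun x => cos (c * x + d1)) (fun x => cos (c * x + d2)) x.
Proof. by rewrite /phase_jump /piecewise; case: ifP. Qed.

Lemma phase_jump2 c d1 d2 p x : (phase_jump c d1 d2 p x).2 =
  piecewise p (fun x => sin (c * x + d1)) (fun x => sin (c * x + d2)) x.
Proof. by rewrite /phase_jump /piecewise; case: ifP. Qed.

Lemma phase_jump_H1 J c d1 d2 p : finite_set J -> J `<=` `[0, 1] -> 0 < p < 1 ->
  J p \/ expi d1 = expi d2 ->
  inH1_S1 (dom `\` J) (phase_jump c d1 d2 p) /\
  {ae mu, forall x, (dom `\` J) x -> twist (dom `\` J) (phase_jump c d1 d2 p) x = c}.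
Proof.
move=> fJ J01 p01 jump; set D := dom `\` J; set u := phase_jump c d1 d2 p.
have oD : open D by exact: open_dom_setD.
have mD : measurable D by exact: open_measurable.
have Ddom : D `<=` dom by move=> x [].
pose u1 := piecewise p (fun x => cos (c * x + d1)) (fun x => cos (c * x + d2)).
pose u2 := piecewise p (fun x => sin (c * x + d1)) (fun x => sin (c * x + d2)).
pose g1 := piecewise p
  (fun x => - c * sin (c * x + d1)) (fun x => - c * sin (c * x + d2)).
pose g2 := piecewise p
  (fun x => c * cos (c * x + d1)) (fun x => c * cos (c * x + d2)).
have u1E : (fun x => (u x).1) = u1 by apply/funext => x; exact: phase_jump1.
have u2E : (fun x => (u x).2) = u2 by apply/funext => x; exact: phase_jump2.
pose M := 1 + `|c|.
have M1 x : `|x| <= 1 -> `|x| <= M.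
  by move=> x1; rewrite (le_trans x1)// lerDl.
have Mc k x : `|k| = `|c| -> `|x| <= 1 -> `|k * x| <= M.
  move=> kc x1; rewrite normrM kc (@le_trans _ _ `|c|)// ?ler_piMr//.
  by rewrite lerDr.
have cmul k f : continuous f -> continuous (fun x => k * f x).
  by move=> cf x; apply: cvgMr; exact: cf.
have cs := continuous_sin_affine; have cc := continuous_cos_affine.
have L2pw f1 f2 : continuous f1 -> continuous f2 ->
    (forall x, `|f1 x| <= M) -> (forall x, `|f2 x| <= M) -> inL2 D (piecewise p f1 f2).
  move=> c1 c2 b1 b2; apply: (inL2_bounded (M := M)) => //.
    exact: measurable_piecewise.
  by move=> x; rewrite /piecewise; case: ifP.
have L2u1 : inL2 D u1 by apply: L2pw => // x; apply: M1; exact: cos_max.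
have L2u2 : inL2 D u2 by apply: L2pw => // x; apply: M1; exact: sin_max.
have L2g1 : inL2 D g1.
  apply: L2pw; try exact: cmul;
  by move=> x; apply: Mc; [rewrite normrN|exact: sin_max].
have L2g2 : inL2 D g2.
  by apply: L2pw; try exact: cmul; move=> x; apply: Mc => //; exact: cos_max.
have w1 : is_weak_derivative D u1 g1.
  apply: (weak_derivative_piecewise (M := M)) => //; try exact: cmul.
  - by move=> x; exact: is_derive_cos_affine.
  - by move=> x; exact: is_derive_cos_affine.
  - by move=> x; split; apply: M1; exact: cos_max.
  - by move=> x; split; apply: Mc; rewrite ?normrN//; exact: sin_max.
  - by case: jump => [|[e1 e2]]; [left|right; rewrite !cosD e1 e2].
have w2 : is_weak_derivative D u2 g2.
  apply: (weak_derivative_piecewise (M := M)) => //; try exact: cmul.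
  - by move=> x; exact: is_derive_sin_affine.
  - by move=> x; exact: is_derive_sin_affine.
  - by move=> x; split; apply: M1; exact: sin_max.
  - by move=> x; split; apply: Mc => //; exact: cos_max.
  - by case: jump => [|[e1 e2]]; [left|right; rewrite !sinD e1 e2].
have H1u1 : inH1 D u1 by split=> //; exists g1.
have H1u2 : inH1 D u2 by split=> //; exists g2.
split.
  split; rewrite ?u1E ?u2E//.
  by apply: aeW => x _; exact: cos2Dsin2.
rewrite /twist u1E u2E.
have [l1 wd1] := weak_derivativeP H1u1; have [l2 wd2] := weak_derivativeP H1u2.
have L := @inL2_L1 _ D _ mD Ddom.
apply: aeS2 (weak_derivative_unique oD (L _ L2u1) (L _ l1) (L _ L2g1) wd1 w1)
            (weak_derivative_unique oD (L _ L2u2) (L _ l2) (L _ L2g2) wd2 w2).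
move=> x e1 e2 Dx; rewrite e1// e2// phase_jump1 phase_jump2 /g1 /g2 /piecewise.
have pyth d : c = c * (cos (c * x + d) ^+ 2 + sin (c * x + d) ^+ 2).
  by rewrite cos2Dsin2 mulr1.
by case: ifP => _; [rewrite [RHS](pyth d1)|rewrite [RHS](pyth d2)]; ring.
Qed.

(** If [u] were in H^1 across [p], its lifting would be continuous there, so the
    limits of [u] from the left and from the right would agree. *)
Lemma phase_jump_notH1 J c d1 d2 p : finite_set J -> 0 < p < 1 -> ~ J p ->
  inH1_S1 (dom `\` J) (phase_jump c d1 d2 p) -> expi d1 = expi d2.
Proof.
move=> fJ /andP[p0 p1] Jp uH1; have oD := open_dom_setD fJ.
have Dp : (dom `\` J) p by split => //; rewrite /dom /= in_itv/= p0.
have /nbhs_ballP[e /= e0 he] := oD _ Dp.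
have sub : `]p - e, p + e[ `<=` dom `\` J by rewrite -ball_itv.
have Ddom : dom `\` J `<=` dom by move=> x [].
have [|k kE] := twist_lifting oD Ddom uH1 _ sub; first lra.
pose th x := k + \int[mu]_(t in `[p - e, x])
  (twist (dom `\` J) (phase_jump c d1 d2 p) \_ (dom `\` J)) t.
have pe : p - e < p + e by lra.
have tw : L1 `[p - e, p + e]
    (twist (dom `\` J) (phase_jump c d1 d2 p) \_ (dom `\` J)).
  have mD := measurable_dom_setD fJ.
  by apply: integrableS (L1_patch mD (twist_L1 mD uH1)).
have cth : {for p, continuous th}.
  have [ct _ _] := (continuous_within_itvP _ pe).1
    (within_continuous_primitive (c := k) (ltW pe) tw).
  by apply: ct; rewrite in_itv/=; apply/andP; split; lra.
have thr : expi (th x) @[x --> p^'+] --> expi (th p).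
  by apply: expi_cvg; exact: cvg_at_right_filter.
have thl : expi (th x) @[x --> p^'-] --> expi (th p).
  by apply: expi_cvg; exact: cvg_at_left_filter.
have aff (F : set_system R) d : Filter F -> F --> p ->
    expi (c * x + d) @[x --> F] --> expi (c * p + d).
  move=> FF Fp; apply: expi_cvg; apply: cvg_trans (@continuous_affine c d p).
  exact: cvg_app.
have El : expi (c * p + d1) = expi (th p).
  apply: (@ae_at_left_unique _ (fun x => expi (c * x + d1))
    (fun x => expi (th x)) (p - e) p) => //.
  - lra.
  - apply: aeS kE => x kE /andP[xe xp]; rewrite /th -kE; last by apply/andP; split; lra.
    by rewrite /phase_jump xp.
  - by apply: aff; exact: cvg_at_left_filter.
have Er : expi (c * p + d2) = expi (th p).
  apply: (@ae_at_right_unique _ (fun x => expi (c * x + d2))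
    (fun x => expi (th x)) p (p + e)) => //.
  - lra.
  - apply: aeS kE => x kE /andP[xp xe]; rewrite /th -kE; last by apply/andP; split; lra.
    by rewrite /phase_jump ltNge (ltW xp).
  - by apply: aff; exact: cvg_at_right_filter.
have : expi (c * p + d1) = expi (c * p + d2) by rewrite El Er.
by move=> /expi_eq[n nE]; rewrite -(expi_periodic d2 n); congr expi; lra.
Qed.

Lemma phase_jump_at0 c d1 d2 p : 0 < p ->
  phase_jump c d1 d2 p @ 0^'+ --> expi d1.
Proof.
move=> p0; apply: (@cvg_trans _ (expi (c * x + d1) @[x --> 0^'+])).
  apply: near_eq_cvg; apply: filterS (nbhs_right_lt p0) => x xp.
  by rewrite /phase_jump xp.
have := @continuous_affine c d1 0.
rewrite /continuous_at mulr0 add0r => /cvg_at_right_filter.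
exact: expi_cvg.
Qed.

Lemma phase_jump_at1 c d1 d2 p : p < 1 ->
  phase_jump c d1 d2 p @ 1^'- --> expi (c + d2).
Proof.
move=> p1; apply: (@cvg_trans _ (expi (c * x + d2) @[x --> 1^'-])).
  apply: near_eq_cvg; apply: filterS (nbhs_left_gt p1) => x xp.
  by rewrite /phase_jump ltNge (ltW xp).
have := @continuous_affine c d2 1; rewrite /continuous_at mulr1 => /cvg_at_left_filter.
exact: expi_cvg.
Qed.

Definition phase_jump_set alpha c d1 d2 p : set R :=
  [set x | [\/ x = 0 /\ expi d1 <> expi 0, x = p /\ expi d1 <> expi d2 |
               x = 1 /\ expi (c + d2) <> expi alpha]].

Lemma has_trace_iff (F : set_system R) u l k :
  (forall m, has_trace F u m -> m = k) -> has_trace F u k ->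
  has_trace F u l <-> k = l.
Proof. by move=> uniq_k uk; split=> [/uniq_k ->|<-]. Qed.

(** A point of the open interval belongs to a jump set only if [u] is not in H^1
    across it, which singles out [p]; the endpoints are decided by the traces. *)
Lemma is_jump_set_phase_jump alpha c d1 d2 p J : 0 < p < 1 ->
  is_jump_set alpha (phase_jump c d1 d2 p) J <-> J = phase_jump_set alpha c d1 d2 p.
Proof.
move=> p01; have /andP[p0 p1] := p01; set u := phase_jump _ _ _ _.
have uu : ae_eq_dom u u by exact: aeW.
have tr0 l : has_trace 0^'+ u l <-> expi d1 = l.
  apply: has_trace_iff => [m mu|].
    by apply: has_trace0_unique uu mu _; exact: phase_jump_at0.
  by exists u; split => //; exact: phase_jump_at0.
have tr1 l : has_trace 1^'- u l <-> expi (c + d2) = l.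
  apply: has_trace_iff => [m mu|].
    by apply: has_trace1_unique uu mu _; exact: phase_jump_at1.
  by exists u; split => //; exact: phase_jump_at1.
have p_neq0 : p <> 0 by move=> pE; rewrite pE ltxx in p0.
have p_neq1 : p <> 1 by move=> pE; rewrite pE ltxx in p1.
split.
  move=> [[fJ J01] uH1 minJ J0 J1].
  have dom_p x : J x -> dom x -> x = p /\ expi d1 <> expi d2.
    move=> Jx Dx; have no := minJ _ Jx Dx.
    have fJx : finite_set (J `\ x) by exact: finite_setD.
    have Jx01 : J `\ x `<=` `[0, 1] by move=> y [/J01].
    split.
      apply: contrapT => xp; apply: no; apply: (phase_jump_H1 _ _ _ p01 _).1 => //.
      have [e|ne] := pselect (expi d1 = expi d2); [by right|left].
      split; last by move=> e; apply: xp.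
      by apply: contrapT => Jp; apply: ne; apply: phase_jump_notH1 uH1.
    by move=> e; apply: no; apply: (phase_jump_H1 _ _ _ p01 _).1 => //; right.
  apply/seteqP; split=> x.
    move=> Jx; have := J01 _ Jx; rewrite /= in_itv/= => /andP[x0 x1].
    have [x0E|x0E] := eqVneq x 0.
      by constructor 1; split=> //; move/tr0; move: Jx; rewrite x0E => /J0.
    have [x1E|x1E] := eqVneq x 1.
      by constructor 3; split=> //; move/tr1; move: Jx; rewrite x1E => /J1.
    constructor 2; apply: dom_p => //.
    by rewrite /dom /= in_itv/= !lt_neqAle x0 x1 x1E eq_sym x0E.
  move=> [[-> h]|[-> h]|[-> h]].
  - by apply/J0 => /tr0.
  - by apply: contrapT => Jp; apply: h; apply: phase_jump_notH1 uH1.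
  - by apply/J1 => /tr1.
move=> ->; set S := phase_jump_set _ _ _ _ _.
have S01 : S `<=` `[0, 1].
  by move=> x [[-> _]|[-> _]|[-> _]]; rewrite /= in_itv/= ?lexx ?ler01 ?(ltW p0) ?(ltW p1).
have fS : finite_set S.
  apply: (@sub_finite_set _ _ (([set 0] `|` [set p]) `|` [set 1])).
    by move=> x /= [[-> _]|[-> _]|[-> _]]; [left; left|left; right|right].
  by rewrite !finite_setU.
split=> //.
- apply: (phase_jump_H1 _ fS S01 p01 _).1.
  have [e|ne] := pselect (expi d1 = expi d2); first by right.
  by left; constructor 2.
- move=> x [[-> _]|[-> ne]|[-> _]]; rewrite /dom /= in_itv/= ?ltxx ?andbF//.
  move=> _ uH1; apply: ne; apply: phase_jump_notH1 uH1 => //.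
    exact: finite_setD.
  by move=> [_]; exact.
- rewrite tr0; split=> [[[]//|[/esym]//|[/esym/eqP]]|h]; first by rewrite oner_eq0.
  by constructor 1.
- rewrite tr1; split=> [[[/eqP]|[/esym]//|[]//]|h]; first by rewrite oner_eq0.
  by constructor 3.
Qed.

End PhaseJump.

(** * Dependence on the almost everywhere class *)

Section Energy.
Context {R : realType}.
Implicit Types (D J : set R) (f g h : R -> R) (u v : R -> R * R) (L alpha c d p : R).

Lemma is_weak_derivative_ae D f g h : measurable D ->
  measurable_fun D f -> measurable_fun D g ->
  {ae mu, forall t, D t -> f t = g t} ->
  is_weak_derivative D f h -> is_weak_derivative D g h.
Proof.
move=> mD mf mg fg fh phi phiC1 phicpt; rewrite -(fh phi)//.
have [_ mphi'] := C1_measurable mD phiC1.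
apply: Rintegral_ae_eq => //; try exact: measurable_funM.
by apply: aeS fg => t e Dt; rewrite e.
Qed.

Lemma ae_sym D f g : {ae mu, forall t, D t -> f t = g t} ->
  {ae mu, forall t, D t -> g t = f t}.
Proof. by apply: aeS => t h /h. Qed.

Lemma weak_derivative_ae D f g : measurable D ->
  measurable_fun D f -> measurable_fun D g ->
  {ae mu, forall t, D t -> f t = g t} ->
  weak_derivative D f = weak_derivative D g.
Proof.
move=> mD mf mg fg; rewrite /weak_derivative; congr get.
apply/seteqP; split=> h [h1 h2]; split => //.
  exact: is_weak_derivative_ae h2.
by apply: is_weak_derivative_ae h2 => //; exact: ae_sym.
Qed.

Lemma inH1_ae D f g : measurable D -> inL2 D f -> inL2 D g ->
  {ae mu, forall t, D t -> f t = g t} -> inH1 D f -> inH1 D g.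
Proof.
move=> mD [mf _] [mg g2] fg [_ [h [h2 fh]]]; split => //; exists h; split => //.
exact: is_weak_derivative_ae fh.
Qed.

Lemma inL2S D D' f : measurable D -> measurable D' -> D' `<=` D ->
  inL2 D f -> inL2 D' f.
Proof.
move=> mD mD' D'D [mf f2]; split; first exact: measurable_funS mf.
exact: integrableS f2.
Qed.

Lemma measurable_dom : measurable (dom : set R).
Proof. exact: measurable_itv. Qed.

Lemma ae_components D u v : D `<=` dom -> ae_eq_dom u v ->
  {ae mu, forall t, D t -> (u t).1 = (v t).1} /\
  {ae mu, forall t, D t -> (u t).2 = (v t).2}.
Proof. by move=> Ddom uv; split; apply: aeS uv => t h /Ddom/h ->. Qed.

Lemma inH1_S1_ae D u v : measurable D -> D `<=` dom ->
  inL2_R2 dom u -> inL2_R2 dom v -> ae_eq_dom u v ->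
  inH1_S1 D u -> inH1_S1 D v.
Proof.
move=> mD Ddom [u1 u2] [v1 v2] uv [H1 H2 S].
have sub f : inL2 dom f -> inL2 D f by apply: inL2S => //; exact: measurable_dom.
have [e1 e2] := ae_components Ddom uv.
split.
- by apply: inH1_ae e1 H1 => //; exact: sub.
- by apply: inH1_ae e2 H2 => //; exact: sub.
- by apply: aeS3 e1 e2 S => t h1 h2 h Dt; rewrite -h1// -h2// h.
Qed.

Lemma ae_eq_dom_sym u v : ae_eq_dom u v -> ae_eq_dom v u.
Proof. by apply: aeS => t h /h. Qed.

Lemma ae_eq_dom_trans u v w : ae_eq_dom u v -> ae_eq_dom v w -> ae_eq_dom u w.
Proof. by apply: aeS2 => t h1 h2 Dt; rewrite h1// h2. Qed.

Lemma has_trace_ae (F : set_system R) u v l :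
  ae_eq_dom u v -> has_trace F u l <-> has_trace F v l.
Proof.
move=> uv; split=> -[w [we wl]]; exists w; split => //.
  exact: ae_eq_dom_trans uv.
by apply: ae_eq_dom_trans we _; exact: ae_eq_dom_sym.
Qed.

Lemma is_jump_set_ae alpha u v J : inL2_R2 dom u -> inL2_R2 dom v ->
  ae_eq_dom u v -> is_jump_set alpha u J -> is_jump_set alpha v J.
Proof.
move=> u2 v2 uv [[fJ J01] uH minJ J0 J1].
have vu := ae_eq_dom_sym uv.
split => //.
- by apply: inH1_S1_ae uv uH => //; exact: measurable_dom_setD.
- move=> x Jx Dx vH; apply: (minJ _ Jx Dx); apply: inH1_S1_ae vu vH => //.
  by apply: measurable_dom_setD; exact: finite_setD.
- by rewrite J0 (has_trace_ae _ _ uv).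
- by rewrite J1 (has_trace_ae _ _ uv).
Qed.

Lemma twist_ae D u v : measurable D -> D `<=` dom ->
  inL2_R2 dom u -> inL2_R2 dom v -> ae_eq_dom u v ->
  {ae mu, forall x, D x -> twist D u x = twist D v x}.
Proof.
move=> mD Ddom [u1 u2] [v1 v2] uv; have [e1 e2] := ae_components Ddom uv.
have sub f : inL2 dom f -> measurable_fun D f.
  by move=> [mf _]; apply: measurable_funS mf => //; exact: measurable_dom.
rewrite /twist (weak_derivative_ae mD (sub _ u1) (sub _ v1) e1).
rewrite (weak_derivative_ae mD (sub _ u2) (sub _ v2) e2).
by apply: aeS2 e1 e2 => x h1 h2 Dx; rewrite h1// h2.
Qed.

Lemma jump_setP alpha u J : is_jump_set alpha u J ->
  is_jump_set alpha u (jump_set alpha u).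
Proof. by move=> uJ; apply: getPex; exists J. Qed.

Lemma E0_ae L N alpha u v : inL2_R2 dom u -> inL2_R2 dom v ->
  ae_eq_dom u v -> E0 L N alpha u = E0 L N alpha v.
Proof.
move=> u2 v2 uv.
have isJ : is_jump_set alpha u = is_jump_set alpha v.
  apply/funext => J; apply/propext; split; first exact: is_jump_set_ae.
  by apply: is_jump_set_ae => //; exact: ae_eq_dom_sym.
have JE : jump_set alpha u = jump_set alpha v by rewrite /jump_set isJ.
rewrite /E0 isJ; case: ifPn => // /asboolP[J vJ].
have uJ : is_jump_set alpha u J by rewrite isJ.
rewrite JE; have [[fJ _] vH _ _ _] := jump_setP vJ.
have [_ uH _ _ _] := jump_setP uJ; rewrite JE in uH.
set D := dom `\` _ in vH uH *.
have mD : measurable D by exact: measurable_dom_setD.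
have Ddom : D `<=` dom by move=> x [].
pose dev w x := ((twist D w x - 2 * pi * N%:R) ^+ 2)%:E.
have mdev w : inH1_S1 D w -> measurable_fun D (dev w).
  move=> wH; apply/measurable_EFinP/measurable_funX/measurable_funB => //.
  by apply: L1_measurable; exact: twist_L1.
have uv_dev : (\int[mu]_(x in D) dev u x = \int[mu]_(x in D) dev v x)%E.
  apply: ae_eq_integral; [exact: mD|exact: mdev|exact: mdev|].
  by apply: aeS (twist_ae mD Ddom u2 v2 uv) => x h Dx; rewrite /dev h.
by rewrite uv_dev.
Qed.

(** * Energy of phases with one jump *)

Lemma phase_jump_L2 c d1 d2 p : inL2_R2 dom (@phase_jump R c d1 d2 p).
Proof.
split; apply: (inL2_bounded (M := 1)) => //.
- exact: measurable_dom.
- have -> : (fun x => (phase_jump c d1 d2 p x).1) = piecewise p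
    (fun x => cos (c * x + d1)) (fun x => cos (c * x + d2)).
    by apply/funext => x; exact: phase_jump1.
  by apply: measurable_piecewise; [exact: measurable_dom|exact: continuous_cos_affine..].
- by move=> x; exact: cos_max.
- exact: measurable_dom.
- have -> : (fun x => (phase_jump c d1 d2 p x).2) = piecewise p
    (fun x => sin (c * x + d1)) (fun x => sin (c * x + d2)).
    by apply/funext => x; exact: phase_jump2.
  by apply: measurable_piecewise; [exact: measurable_dom|exact: continuous_sin_affine..].
- by move=> x; exact: sin_max.
Qed.

Lemma mu_dom_setD J : finite_set J -> mu (dom `\` J) = 1%:E :> \bar R.
Proof.
move=> fJ; have mJ : measurable J.
  by apply: countable_measurable => //; exact: finite_set_countable.
rewrite measureD//; last 2 first.
- exact: measurable_dom.
- by apply: dom_measure_lty => //; exact: measurable_dom.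
rewrite [X in (_ - X)%E](_ : _ = 0%E); last first.
  by apply: finite_measure0; exact: finite_setIr.
by rewrite sube0 /dom /= lebesgue_measure_itv/= lte_fin ltr01 -EFinD subr0.
Qed.

Lemma jump_set_phase_jump alpha c d1 d2 p : 0 < p < 1 ->
  jump_set alpha (phase_jump c d1 d2 p) = phase_jump_set alpha c d1 d2 p.
Proof.
move=> p01; apply/(is_jump_set_phase_jump alpha c d1 d2 _ p01).
by apply: jump_setP; apply/is_jump_set_phase_jump.
Qed.

Lemma phase_jump_has_jump_set alpha c d1 d2 p : 0 < p < 1 ->
  has_jump_set alpha (phase_jump c d1 d2 p) (phase_jump_set alpha c d1 d2 p).
Proof.
by move=> p01; split; [apply/is_jump_set_phase_jump|exact: jump_set_phase_jump].
Qed.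

Lemma phase_jump_constant_twist alpha c d1 d2 p : 0 < p < 1 ->
  has_constant_twist alpha (phase_jump c d1 d2 p) c.
Proof.
move=> p01; rewrite /has_constant_twist jump_set_phase_jump//.
have [[[fJ J01] _ _ _ _] _] := phase_jump_has_jump_set alpha c d1 d2 p01.
apply: (phase_jump_H1 c fJ J01 p01 _).2.
have [e|ne] := pselect (expi d1 = expi d2); first by right.
by left; constructor 2.
Qed.

Lemma E0_phase_jump L N alpha c d1 d2 p : 0 < p < 1 ->
  E0 L N alpha (phase_jump c d1 d2 p) =
  ((L / 2 * (c - 2 * pi * N%:R) ^+ 2)%:E +
   (2 * Num.sqrt 2 / 3)%:E * counting (phase_jump_set alpha c d1 d2 p))%E.
Proof.
move=> p01; have [uJ JE] := phase_jump_has_jump_set alpha c d1 d2 p01.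
rewrite /E0 ifT; last by apply/asboolP; exists (phase_jump_set alpha c d1 d2 p).
have [[fJ J01] uH _ _ _] := uJ.
have := phase_jump_constant_twist alpha c d1 d2 p01.
rewrite /has_constant_twist JE; set D := dom `\` _ in uH * => tw.
have mD : measurable D by exact: measurable_dom_setD.
have intE : (\int[mu]_(x in D)
    ((twist D (phase_jump c d1 d2 p) x - 2 * pi * N%:R) ^+ 2)%:E =
    ((c - 2 * pi * N%:R) ^+ 2)%:E)%E.
  rewrite (@ae_eq_integral _ _ _ _ _ (fun=> ((c - 2 * pi * N%:R) ^+ 2)%:E)).
  - by rewrite integral_cst// [X in (_ * X)%E](mu_dom_setD fJ) mule1.
  - exact: mD.
  - apply/measurable_EFinP/measurable_funX/measurable_funB => //.
    by apply: L1_measurable; exact: twist_L1.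
  - exact: measurable_cst.
  - by apply: aeS tw => x h Dx; rewrite h.
by rewrite intE -EFinM.
Qed.

End Energy.

(** * Lower bounds for the energy *)

Section LowerBounds.
Context {R : realType}.
Implicit Types (D J : set R) (u v : R -> R * R) (L alpha c m p : R).

Lemma constant_twist_phase D u a b m : open D -> D `<=` dom -> inH1_S1 D u ->
  a < b -> `]a, b[ `<=` D -> {ae mu, forall x, D x -> twist D u x = m} ->
  exists c, {ae mu, forall x, a < x < b -> u x = expi (m * x + c)}.
Proof.
move=> oD Ddom uH ab abD tm; have [c uE] := twist_lifting oD Ddom uH ab abD.
exists (c - m * a); apply: aeS uE => x uE xab; rewrite uE//; congr expi.
have /andP[ax xb] := xab; have mD : measurable D by exact: open_measurable.
have mx : mu (`[a, x] : set R) = (x - a)%:E.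
  by rewrite /= lebesgue_measure_itv/= lte_fin ax -EFinD.
have itw : L1 `[a, x] (twist D u \_ D).
  by apply: integrableS (L1_patch mD (twist_L1 mD uH)).
have im : L1 `[a, x] (fun=> m).
  apply: measurable_bounded_integrable => //.
    by rewrite [X in (X < _)%E]mx ltry.
  by exists `|m|; split => // M cM t _; rewrite ltW.
rewrite (Rintegral_itv_ae_eq itw im); last first.
  apply: aeS tm => t tm /andP[at' tx].
  have Dt : D t by apply: abD; rewrite /= in_itv/= at' (lt_trans tx).
  by rewrite patchE mem_set// tm.
rewrite Rintegral_cst; last exact: measurable_itv.
by rewrite [X in fine X]mx /=; ring.
Qed.

(** The traces of the lifting [theta] at [0] and [1] show that the mean of the
    twist [tau] is [m = alpha + 2 pi k].  Hence
    [int (tau - a)^2 = int (tau - m)^2 + (m - a)^2], and equality with the last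
    term forces [tau = m]. *)
Lemma twist_energy_no_jump alpha u (a : R) : is_jump_set alpha u set0 ->
  exists k : int, let m := alpha + 2 * pi * k%:~R in
    let I := (\int[mu]_(x in dom `\` set0)
                ((twist (dom `\` set0) u x - a) ^+ 2)%:E)%E in
    (((m - a) ^+ 2)%:E <= I)%E /\
    ((I <= ((m - a) ^+ 2)%:E)%E -> ae_eq_dom u (fun x => expi (m * x))).
Proof.
move=> [_ uH _ J0 J1]; set D := dom `\` set0 in uH *.
have oD : open D by exact: open_dom_setD.
have mD : measurable D by exact: open_measurable.
have Ddom : D `<=` dom by move=> x [].
have domD : `]0, 1[ `<=` D by move=> x hx; split.
have tw := twist_L1 mD uH.
have [c uE] := twist_lifting oD Ddom uH ltr01 domD.
pose th x := c + \int[mu]_(t in `[0, x]) (twist D u \_ D) t.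
have tw01 : L1 `[0, 1] (twist D u \_ D) by apply: integrableS (L1_patch mD tw).
have [_ th0 th1] := (continuous_within_itvP _ ltr01).1
  (within_continuous_primitive (c := c) ler01 tw01).
have uth : ae_eq_dom u (fun x => expi (th x)).
  by apply: aeS uE => x h; rewrite /dom /= in_itv; exact: h.
have trace0 : has_trace 0^'+ u (expi 0) by apply: contrapT => h; exact: J0.2 h.
have trace1 : has_trace 1^'- u (expi alpha) by apply: contrapT => h; exact: J1.2 h.
have e0 : expi 0 = expi (th 0).
  by apply: has_trace0_unique uth trace0 _; exact: expi_cvg th0.
have e1 : expi alpha = expi (th 1).
  by apply: has_trace1_unique uth trace1 _; exact: expi_cvg th1.
have th0E : th 0 = c by rewrite /th set_itv1 Rintegral_set1 addr0.
rewrite th0E in e0; have [i iE] := expi_eq (esym e0).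
have [j jE] := expi_eq (esym e1).
have twE : \int[mu]_(x in D) twist D u x = th 1 - c.
  rewrite /th addrC addKr [RHS](@Rintegral_support _ _ D).
  - by apply: eq_Rintegral => x xD; rewrite patchE xD.
  - by move=> x /Ddom; exact: subset_itv_oo_cc.
  - by move=> x _ Dx; rewrite patchE (memNset Dx).
exists (j - i) => /=; set m := alpha + _.
have mE : th 1 - c = m by rewrite jE iE /m rmorphB/=; ring.
rewrite mE in twE.
set I := (\int[mu]_(x in D) _)%E.
have mf k : measurable_fun D (fun x => (twist D u x - k) ^+ 2).
  by apply/measurable_funX/measurable_funB => //; exact: L1_measurable.
(* the energy is infinite when the twist is not square integrable *)
have [Ioo|Ifin] := eqVneq I +oo%E.
  by rewrite Ioo leey; split => //; rewrite leye_eq.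
have i1 : L1 D (fun x => (twist D u x - a) ^+ 2).
  apply/integrableP; split; first by apply/measurable_EFinP; exact: mf.
  under eq_integral do rewrite /= ger0_norm ?sqr_ge0//.
  by rewrite ltey; exact: Ifin.
have Lc k : L1 D (fun=> k) by exact: L1_cst.
have i2 : L1 D (fun x => 2 * (m - a) * (twist D u x - m)).
  by apply: L1Z => //; exact: L1B.
have i3 : L1 D (fun x => (twist D u x - m) ^+ 2).
  have := L1B mD (L1B mD i1 i2) (Lc ((m - a) ^+ 2)).
  by apply: eq_integrable => // x _ /=; congr EFin; ring.
have muD : fine (mu D) = 1 by rewrite [X in fine X]mu_dom_setD.
pose K := \int[mu]_(x in D) ((twist D u x - m) ^+ 2).
have IE : I = (K + (m - a) ^+ 2)%:E.
  rewrite -[LHS]fineK; last by exact: integrable_fin_num.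
  congr EFin; rewrite -[LHS]/(\int[mu]_(x in D) ((twist D u x - a) ^+ 2)).
  transitivity (\int[mu]_(x in D) ((twist D u x - m) ^+ 2 +
     (2 * (m - a) * (twist D u x - m) + (m - a) ^+ 2))).
    by apply: eq_Rintegral => x _; ring.
  rewrite RintegralD//; last by apply: L1D.
  rewrite RintegralD// RintegralZl//; last by apply: L1B.
  rewrite RintegralB// !Rintegral_cst// twE muD !mulr1 subrr mulr0 add0r//.
have K0 : 0 <= K by apply: Rintegral_ge0 => x _; exact: sqr_ge0.
rewrite IE !lee_fin lerDr; split => // Kle.
have {K0 Kle} K0 : K = 0 by lra.
have tm : {ae mu, forall x, D x -> twist D u x = m}.
  have : (\int[mu]_(x in D) `|((twist D u x - m) ^+ 2)%:E| = 0)%E.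
    under eq_integral do rewrite /= ger0_norm ?sqr_ge0//.
    rewrite -[LHS]fineK; last by exact: integrable_fin_num.
    by rewrite -[fine _]/K K0.
  have mEF : measurable_fun D (fun x => ((twist D u x - m) ^+ 2)%:E).
    by apply/measurable_EFinP; exact: mf.
  move=> /(ae_eq_integral_abs mu mD mEF).1; apply: aeS => x h Dx.
  have /eqP := h Dx; rewrite eqe sqrf_eq0 subr_eq0 => /eqP.
  exact.
have [c' uE'] := constant_twist_phase oD Ddom uH ltr01 domD tm.
have uc : ae_eq_dom u (fun x => expi (m * x + c')).
  by apply: aeS uE' => x h; rewrite /dom /= in_itv; exact: h.
have e0' : expi 0 = expi c'.
  apply: has_trace0_unique uc trace0 _; apply: expi_cvg; apply: cvg_at_right_filter.
  by have := @continuous_affine _ m c' 0; rewrite /continuous_at mulr0 add0r.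
have [n nE] := expi_eq (esym e0').
apply: aeS uc => x h Dx; rewrite h// -[RHS](expi_periodic _ n); congr expi.
by rewrite nE add0r.
Qed.

End LowerBounds.

Section JumpCase.
Context {R : realType}.
Implicit Types (D J : set R) (u v : R -> R * R) (L alpha a b c m p x : R) (N : nat).

Lemma phase_from_trace0 u m c b : 0 < b -> b <= 1 ->
  has_trace 0^'+ u (expi 0) -> {ae mu, forall x, 0 < x < b -> u x = expi (m * x + c)} ->
  {ae mu, forall x, 0 < x < b -> u x = expi (m * x)}.
Proof.
move=> b0 b1 [w [wu w0]] uE.
have e : expi 0 = expi c.
  apply: (@ae_at_right_unique _ w (fun x => expi (m * x + c)) 0 b) => //.
    apply: aeS2 wu uE => x h1 h2 /andP[x0 xb]; rewrite h1 ?h2 ?x0//.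
    by rewrite /dom /= in_itv/= x0 (lt_le_trans xb).
  apply: expi_cvg; apply: cvg_at_right_filter.
  by have := @continuous_affine _ m c 0; rewrite /continuous_at mulr0 add0r.
have [n nE] := expi_eq (esym e).
apply: aeS uE => x h xb; rewrite h// -[RHS](expi_periodic _ n); congr expi.
by rewrite nE add0r.
Qed.

(** The trace at [1] determines [c] because [2 pi N] is a multiple of [2 pi]. *)
Lemma phase_from_trace1 alpha u N c a : 0 <= a -> a < 1 ->
  has_trace 1^'- u (expi alpha) ->
  {ae mu, forall x, a < x < 1 -> u x = expi (2 * pi * N%:R * x + c)} ->
  {ae mu, forall x, a < x < 1 -> u x = expi (2 * pi * N%:R * x + alpha)}.
Proof.
move=> a0 a1 [w [wu w1]] uE.
have e : expi alpha = expi (2 * pi * N%:R + c).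
  apply: (@ae_at_left_unique _ w (fun x => expi (2 * pi * N%:R * x + c)) a 1) => //.
    apply: aeS2 wu uE => x h1 h2 /andP[xa x1]; rewrite h1 ?h2 ?xa//.
    by rewrite /dom /= in_itv/= x1 (le_lt_trans a0).
  apply: expi_cvg; apply: cvg_at_left_filter.
  by have := @continuous_affine _ (2 * pi * N%:R) c 1; rewrite /continuous_at mulr1.
have [n nE] := expi_eq (esym e).
apply: aeS uE => x h xb; rewrite h// -[RHS](expi_periodic _ (n - N%:Z)); congr expi.
by rewrite intrB -pmulrn; lra.
Qed.

(** Energy at most the cost of one jump leaves exactly one jump point [p] and
    twist [2 pi N].  Then [u] has constant angular speed on both sides of [p];
    the phase on the left is fixed by the trace at [0] and the phase on the right
    by the trace at [1].  When [p] is an endpoint only the opposite trace is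
    available, and only that side is nonempty. *)
Lemma twist_energy_jump L N alpha u J : 0 < L -> is_jump_set alpha u J -> J !=set0 ->
  let E := ((L / 2)%:E *
    (\int[mu]_(x in dom `\` J) ((twist (dom `\` J) u x - 2 * pi * N%:R) ^+ 2)%:E) +
    (2 * Num.sqrt 2 / 3)%:E * counting J)%E in
  ((2 * Num.sqrt 2 / 3)%:E <= E)%E /\
  ((E <= (2 * Num.sqrt 2 / 3)%:E)%E ->
   exists2 p, 0 <= p <= 1 & ae_eq_dom u (one_jump N alpha p)).
Proof.
move=> L0 [[fJ J01] uH _ J0 J1] [q Jq] /=.
set D := dom `\` J in uH *; set I := (\int[mu]_(x in D) _)%E.
set k := 2 * Num.sqrt 2 / 3.
have k0 : 0 < k by rewrite divr_gt0// mulr_gt0// sqrtr_gt0.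
have I0 : (0 <= I)%E by apply: integral_ge0 => x _; rewrite lee_fin sqr_ge0.
have cJ : counting J = (#|` fset_set J|)%:R%:E :> \bar R by rewrite /counting asboolT.
have n1 : (1 <= #|` fset_set J|)%N.
  by rewrite cardfs_gt0; apply/fset0Pn; exists q; rewrite in_fset_set// mem_set.
have LI0 : (0 <= (L / 2)%:E * I)%E by rewrite mule_ge0// lee_fin divr_ge0// ltW.
rewrite cJ -EFinM; set n := #|` fset_set J| in n1 *.
have kn : k <= k * n%:R by rewrite -{1}[k]mulr1 ler_pM2l// (ler_nat R 1 n).
split; first by rewrite (@le_trans _ _ (k * n%:R)%:E)// ?lee_fin// leeDr.
move=> Ek.
have Ifin : I \is a fin_num.
  rewrite ge0_fin_numE// ltey; apply/eqP => Ioo; move: Ek; rewrite Ioo.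
  by rewrite gt0_muley ?lte_fin ?divr_gt0// addye// leye_eq.
pose r := fine I; have IE : I = r%:E by rewrite fineK.
have r0 : 0 <= r by rewrite -lee_fin -IE.
move: Ek; rewrite IE -EFinM -EFinD lee_fin => Ek.
have Lr0 : 0 <= L / 2 * r by rewrite mulr_ge0// divr_ge0// ltW.
have {Ek} [rE nE] : r = 0 /\ (n <= 1)%N.
  split.
    have : L / 2 * r <= 0 by lra.
    by rewrite pmulr_rle0 ?divr_gt0// => r0'; apply/eqP; rewrite eq_le r0 r0'.
  by rewrite -(ler_nat R) -(ler_pM2l k0) mulr1; lra.
have /eqP/cardfs1P[p pE] : n = 1%N by apply/eqP; rewrite eqn_leq nE.
have {pE} JE : J = [set p].
  by rewrite -(fset_setK fJ) pE; apply/seteqP; split=> x /=;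
    rewrite in_fset1 => /eqP.
have oD : open D by exact: open_dom_setD.
have mD : measurable D by exact: open_measurable.
have Ddom : D `<=` dom by move=> x [].
have tw : {ae mu, forall x, D x -> twist D u x = 2 * pi * N%:R}.
  have mEF : measurable_fun D (fun x => ((twist D u x - 2 * pi * N%:R) ^+ 2)%:E).
    apply/measurable_EFinP/measurable_funX/measurable_funB => //.
    by apply: L1_measurable; exact: twist_L1.
  have : (\int[mu]_(x in D) `|((twist D u x - 2 * pi * N%:R) ^+ 2)%:E| = 0)%E.
    under eq_integral do rewrite /= ger0_norm ?sqr_ge0//.
    by rewrite -/I IE rE.
  move=> /(ae_eq_integral_abs mu mD mEF).1; apply: aeS => x h Dx.
  have /eqP := h Dx; rewrite eqe sqrf_eq0 subr_eq0 => /eqP.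
  exact.
have p01 : 0 <= p <= 1 by have := J01 p; rewrite JE /= in_itv/=; apply.
exists p => //; have /andP[p0 p1] := p01.
have left_phase : 0 < p ->
    {ae mu, forall x, 0 < x < p -> u x = expi (2 * pi * N%:R * x)}.
  move=> p_gt0.
  have sub : `]0, p[ `<=` D.
    move=> x /=; rewrite in_itv/= => /andP[x0 xp]; split.
      by rewrite /dom /= in_itv/= x0 (lt_le_trans xp).
    by rewrite JE /= => xE; rewrite xE ltxx in xp.
  have [c uE] := constant_twist_phase oD Ddom uH p_gt0 sub tw.
  apply: phase_from_trace0 uE => //; apply: contrapT => /J0.
  by rewrite JE /= => e; rewrite -e ltxx in p_gt0.
have right_phase : p < 1 ->
    {ae mu, forall x, p < x < 1 -> u x = expi (2 * pi * N%:R * x + alpha)}.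
  move=> p_lt1.
  have sub : `]p, 1[ `<=` D.
    move=> x /=; rewrite in_itv/= => /andP[px x1]; split.
      by rewrite /dom /= in_itv/= x1 (le_lt_trans p0).
    by rewrite JE /= => xE; rewrite xE ltxx in px.
  have [c uE] := constant_twist_phase oD Ddom uH p_lt1 sub tw.
  apply: phase_from_trace1 uE => //; apply: contrapT => /J1.
  by rewrite JE /= => e; rewrite -e ltxx in p_lt1.
have neq_p : {ae mu, forall x, x != p}.
  exists [set p]; split; [exact: measurable_set1|exact: lebesgue_measure_set1|].
  by move=> x /= /negP; rewrite negbK => /eqP.
have lp : {ae mu, forall x, 0 < x < p -> u x = expi (2 * pi * N%:R * x)}.
  have [|h] := ltP 0 p; first exact: left_phase.
  by apply: aeW => x /andP[x0 xp]; move: (lt_le_trans xp h); rewrite ltNge ltW.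
have rp : {ae mu, forall x, p < x < 1 -> u x = expi (2 * pi * N%:R * x + alpha)}.
  have [|h] := ltP p 1; first exact: right_phase.
  by apply: aeW => x /andP[px x1]; move: (le_lt_trans h px); rewrite ltNge ltW.
apply: aeS3 neq_p lp rp => x xp hl hr.
rewrite /dom /= in_itv/= /one_jump => /andP[x0 x1].
move: xp; rewrite neq_lt => /orP[xp|px]; first by rewrite xp hl ?x0.
by rewrite ltNge (ltW px) /= hr ?px.
Qed.

Lemma E0_lower_bound L N alpha u : 0 < L ->
  [\/ E0 L N alpha u = +oo%E,
      exists k : int, let m := alpha + 2 * pi * k%:~R in
        ((L / 2 * (m - 2 * pi * N%:R) ^+ 2)%:E <= E0 L N alpha u)%E /\
        ((E0 L N alpha u <= (L / 2 * (m - 2 * pi * N%:R) ^+ 2)%:E)%E ->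
         ae_eq_dom u (fun x => expi (m * x))) |
      ((2 * Num.sqrt 2 / 3)%:E <= E0 L N alpha u)%E /\
      ((E0 L N alpha u <= (2 * Num.sqrt 2 / 3)%:E)%E ->
       exists2 p, 0 <= p <= 1 & ae_eq_dom u (one_jump N alpha p))].
Proof.
move=> L0.
have [[J uJ]|noJ] := pselect (exists J, is_jump_set alpha u J); last first.
  by constructor 1; rewrite /E0 asboolF.
have {}uJ := jump_setP uJ.
have -> : E0 L N alpha u = ((L / 2)%:E *
    (\int[mu]_(x in dom `\` jump_set alpha u)
      ((twist (dom `\` jump_set alpha u) u x - 2 * pi * N%:R) ^+ 2)%:E) +
    (2 * Num.sqrt 2 / 3)%:E * counting (jump_set alpha u))%E.
  by rewrite /E0 asboolT//; exists (jump_set alpha u).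
move: (jump_set alpha u) uJ => {}J uJ.
have [J0|/set0P J0] := eqVneq J set0; last by constructor 3; exact: twist_energy_jump.
constructor 2; rewrite J0 in uJ *.
have [k [h1 h2]] := twist_energy_no_jump (2 * pi * N%:R) uJ.
have L20 : 0 < L / 2 by rewrite divr_gt0.
have -> : counting (set0 : set R) = 0%E :> \bar R.
  by rewrite /counting asboolT// fset_set0.
exists k; rewrite /= mule0 adde0 EFinM; split.
  by rewrite lee_pmul2l// lte_fin.
by rewrite lee_pmul2l ?lte_fin//; exact: h2.
Qed.

End JumpCase.

(** * Minimizers *)

Section Minimizers.
Context {R : realType}.
Implicit Types (D J : set R) (u v : R -> R * R) (L alpha a b c m p : R) (N : nat).

Local Notation jump_cost := (2 * Num.sqrt 2 / 3).

Lemma expi_phase_jump c : (fun x => expi (c * x)) = phase_jump c 0 0 2^-1.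
Proof. by apply/funext => x; rewrite /phase_jump if_same addr0. Qed.

Lemma one_jump_phase_jump N alpha p :
  one_jump N alpha p = phase_jump (2 * pi * N%:R) 0 alpha p.
Proof.
by apply/funext => x; rewrite /phase_jump /one_jump; case: ifP; rewrite ?addr0.
Qed.

Lemma half_in01 : 0 < (2^-1 : R) < 1.
Proof. by apply/andP; split; lra. Qed.

Lemma phase_jump_set_expi alpha c : expi c = expi alpha ->
  phase_jump_set alpha c 0 0 2^-1 = set0.
Proof.
by move=> e; rewrite -subset0 => x [[_]|[_]|[_]]; rewrite ?addr0.
Qed.

Lemma expi_N_turns alpha N : expi (2 * pi * N%:R + alpha) = expi alpha.
Proof. by rewrite addrC -(expi_periodic alpha N) -pmulrn. Qed.

Lemma counting_set0 : counting (set0 : set R) = 0%E :> \bar R.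
Proof. by rewrite /counting asboolT// fset_set0. Qed.

Lemma counting_set1 p : counting [set p] = 1%E :> \bar R.
Proof. by rewrite /counting asboolT// fset_set1 cardfs1. Qed.

Lemma E0_expi L N alpha c : expi c = expi alpha ->
  E0 L N alpha (fun x => expi (c * x)) = (L / 2 * (c - 2 * pi * N%:R) ^+ 2)%:E.
Proof.
move=> e; rewrite expi_phase_jump E0_phase_jump ?half_in01//.
by rewrite phase_jump_set_expi// counting_set0 mule0 adde0.
Qed.

Lemma phase_jump_set_one_jump N alpha p : expi alpha <> expi 0 -> 0 < p < 1 ->
  phase_jump_set alpha (2 * pi * N%:R) 0 alpha p = [set p].
Proof.
move=> ne p01; apply/seteqP; split=> x.
  by move=> [[_]//|[-> _]//|[_]]; rewrite expi_N_turns.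
by move=> ->; constructor 2; split=> // /esym.
Qed.

(** For [p = 0] or [p = 1] the function is, on the domain, a single phase that
    violates the boundary condition at [p]; the jump sits at the endpoint. *)
Lemma E0_one_jump L N alpha p : expi alpha <> expi 0 -> 0 <= p <= 1 ->
  E0 L N alpha (one_jump N alpha p) = jump_cost%:E.
Proof.
move=> ne /andP[p0 p1].
have phaseE d1 d2 q r : 0 < q < 1 ->
    phase_jump_set alpha (2 * pi * N%:R) d1 d2 q = [set r] ->
    E0 L N alpha (phase_jump (2 * pi * N%:R) d1 d2 q) = jump_cost%:E.
  move=> q01 qr; rewrite E0_phase_jump// qr counting_set1 mule1.
  by rewrite subrr expr0n mulr0 add0e.
have ae_phase d :
    ae_eq_dom (one_jump N alpha p) (phase_jump (2 * pi * N%:R) d d 2^-1) ->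
    E0 L N alpha (one_jump N alpha p) =
    E0 L N alpha (phase_jump (2 * pi * N%:R) d d 2^-1).
  by apply: E0_ae; rewrite ?one_jump_phase_jump; exact: phase_jump_L2.
have [pE|p_neq0] := eqVneq p 0.
  rewrite (ae_phase alpha); last first.
    apply: aeW => x; rewrite /dom /= in_itv/= => /andP[x0 _].
    by rewrite /one_jump /phase_jump pE ltNge (ltW x0) if_same.
  apply: (phaseE _ _ _ 0); first exact: half_in01.
  apply/seteqP; split=> x; last by move=> ->; constructor 1.
  by move=> [[->]//|[_]//|[_]]; rewrite expi_N_turns.
have [pE|p_neq1] := eqVneq p 1.
  rewrite (ae_phase 0); last first.
    apply: aeW => x; rewrite /dom /= in_itv/= => /andP[_ x1].
    by rewrite /one_jump /phase_jump pE x1 if_same addr0.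
  apply: (phaseE _ _ _ 1); first exact: half_in01.
  apply/seteqP; split=> x; last first.
    by move=> ->; constructor 3; split => //; rewrite expi_N_turns => /esym.
  by move=> [[_]//|[_]//|[->]].
have p01 : 0 < p < 1 by rewrite !lt_neqAle p0 p1 p_neq1 eq_sym p_neq0.
by rewrite one_jump_phase_jump (phaseE _ _ _ p)//; exact: phase_jump_set_one_jump.
Qed.

Lemma no_jump_minimizers L N alpha (k0 : int) c : 0 < L ->
  c = alpha + 2 * pi * k0%:~R ->
  (forall k : int, (c - 2 * pi * N%:R) ^+ 2 <=
     (alpha + 2 * pi * k%:~R - 2 * pi * N%:R) ^+ 2) ->
  L * (c - 2 * pi * N%:R) ^+ 2 < 4 * Num.sqrt 2 / 3 ->
  (forall v, (E0 L N alpha (fun x => expi (c * x)%R) <= E0 L N alpha v)%E) /\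
  forall u, (E0 L N alpha u <= E0 L N alpha (fun x => expi (c * x)%R))%E ->
    exists k : int,
      (alpha + 2 * pi * k%:~R - 2 * pi * N%:R) ^+ 2 = (c - 2 * pi * N%:R) ^+ 2 /\
      ae_eq_dom u (fun x => expi ((alpha + 2 * pi * k%:~R) * x)).
Proof.
move=> L0 cE cmin Lc; have L20 : 0 < L / 2 by rewrite divr_gt0.
rewrite E0_expi; last by rewrite cE expi_periodic.
set e := L / 2 * (c - 2 * pi * N%:R) ^+ 2.
have e_lt : e < jump_cost by rewrite /e; lra.
split=> [v|u ue].
  have [->|[k /= [h _]]|[h _]] := E0_lower_bound N alpha v L0; first by rewrite leey.
    by apply: le_trans h; rewrite lee_fin /e ler_pM2l.
  by apply: le_trans h; rewrite lee_fin ltW.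
have [uE|[k /= [h1 h2]]|[h _]] := E0_lower_bound N alpha u L0.
- by rewrite uE leye_eq in ue.
- exists k; have eq_k : (alpha + 2 * pi * k%:~R - 2 * pi * N%:R) ^+ 2 =
      (c - 2 * pi * N%:R) ^+ 2.
    apply/eqP; rewrite eq_le cmin andbT.
    by have := le_trans h1 ue; rewrite lee_fin /e ler_pM2l.
  by split=> //; apply: h2; rewrite eq_k.
- by have := le_trans h ue; rewrite lee_fin leNgt e_lt.
Qed.

(** The assumption also excludes [expi alpha = expi 0]: [alpha] would be a multiple
    of [2 pi], and the right-hand side would vanish for some [k]. *)
Lemma jump_minimizers L N alpha : 0 < L ->
  (forall k : int, 4 * Num.sqrt 2 / 3 <
     L * (alpha + 2 * pi * k%:~R - 2 * pi * N%:R) ^+ 2) ->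
  [/\ expi alpha <> expi 0, forall v, (jump_cost%:E <= E0 L N alpha v)%E &
   forall u, (E0 L N alpha u <= jump_cost%:E)%E ->
     exists2 p, 0 <= p <= 1 & ae_eq_dom u (one_jump N alpha p)].
Proof.
move=> L0 big; split=> [|v|u ue].
- move=> /expi_eq[n nE]; have := big (N%:Z - n); rewrite nE intrB -pmulrn.
  rewrite [X in X ^+ 2](_ : _ = 0); last by ring.
  by rewrite expr0n mulr0 ltNge divr_ge0// mulr_ge0// sqrtr_ge0.
- have [->|[k /= [h _]]|[h _]] := E0_lower_bound N alpha v L0; first by rewrite leey.
    by apply: le_trans h; rewrite lee_fin; have := big k; lra.
  exact: h.
have [uE|[k /= [h _]]|[_]] := E0_lower_bound N alpha u L0; last exact.
- by rewrite uE leye_eq in ue.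
- have := le_trans h ue; rewrite lee_fin => le_k.
  by have := big k; lra.
Qed.

(** [k - N] is the excess number of turns.  Excess [1] ties with excess [-1] when
    [alpha = 0], whence the condition in the last case. *)
Lemma turns_cases alpha (N : nat) (k : int) : 0 <= alpha -> alpha < 2 * pi ->
  let d := alpha + 2 * pi * k%:~R - 2 * pi * N%:R in
  [\/ k = N, k = (N%:Z - 1)%R |
      alpha ^+ 2 < d ^+ 2 /\ (0 < alpha -> (2 * pi - alpha) ^+ 2 < d ^+ 2)].
Proof.
move=> a0 a2 d; have pi0 := pi_gt0 R.
pose j := k - N%:Z; have dE : d = alpha + 2 * pi * j%:~R.
  by rewrite /d /j intrB -pmulrn; ring.
have [j1|] := lerP 1 j.
  have {}j1 : 1 <= j%:~R :> R by rewrite ler1z.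
  have d_ge : alpha + 2 * pi <= d by rewrite dE lerD2l ler_peMr// mulr_ge0// ltW.
  by constructor 3; split=> [|a_gt0]; nra.
have [j2|] := lerP j (-2).
  have {}j2 : j%:~R <= -2 :> R by rewrite -(ler_int R) in j2.
  have d_le : d <= alpha - 4 * pi by rewrite dE; nra.
  by constructor 3; split=> [|_]; nra.
move=> h1 h2.
have [j0|j_neq0] := eqVneq j 0; first by constructor 1;
  rewrite -[LHS](subrK N%:Z) -/j j0 add0r.
constructor 2; have jE : j = -1 by lia.
by rewrite -[LHS](subrK N%:Z) -/j jE addrC.
Qed.

End Minimizers.

Theorem theorem3p5 (R : realType) (L : R) (N : nat) (alpha : R)
    (L_gt0 : 0 < L) (N_gt0 : (0 < N)%N)
    (alpha_ge0 : 0 <= alpha) (alpha_lt2pi : alpha < 2 * pi) :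
  let case_i :=
    L * alpha ^+ 2 < 4 * Num.sqrt 2 / 3 /\ 0 <= alpha <= pi in
  let case_ii :=
    L * (2 * pi - alpha) ^+ 2 < 4 * Num.sqrt 2 / 3 /\ pi <= alpha < 2 * pi in
  let case_iii :=
    L * alpha ^+ 2 > 4 * Num.sqrt 2 / 3 /\
    L * (2 * pi - alpha) ^+ 2 > 4 * Num.sqrt 2 / 3 in
  let u_i : R -> R * R := fun x => expi ((2 * pi * N%:R + alpha) * x) in
  let u_ii : R -> R * R := fun x => expi ((2 * pi * (N%:R - 1) + alpha) * x) in
  let u_iii : R -> R -> R * R := one_jump N alpha in
  [/\ (* the global minimizers *)
      case_i \/ case_ii \/ case_iii ->
      forall u : R -> R * R, inL2_R2 dom u ->
        (global_minimizer L N alpha u <->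
         [\/ case_i /\ ae_eq_dom u u_i,
             case_ii /\ ae_eq_dom u u_ii |
             case_iii /\
             [\/ (exists x0 : R, 0 < x0 < 1 /\ ae_eq_dom u (u_iii x0)),
                 (* x0 = 0 or 1: the jump is at an endpoint, with the same energy *)
                 ae_eq_dom u (u_iii 0) | ae_eq_dom u (u_iii 1)]]),
      case_i ->
        has_jump_set alpha u_i set0 /\
        has_constant_twist alpha u_i (2 * pi * N%:R + alpha),
      case_ii ->
        has_jump_set alpha u_ii set0 /\
        has_constant_twist alpha u_ii (2 * pi * (N%:R - 1) + alpha) &
      case_iii ->
        forall x0 : R, 0 < x0 < 1 ->
          has_jump_set alpha (u_iii x0) [set x0] /\
          has_constant_twist alpha (u_iii x0) (2 * pi * N%:R)].
Proof.
move=> case_i case_ii case_iii u_i u_ii u_iii; have pi0 := pi_gt0 R.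
have u_iE : u_i = fun x => expi ((alpha + 2 * pi * (N%:Z)%:~R) * x).
  by apply/funext => x; rewrite /u_i addrC -pmulrn.
have u_iiE : u_ii = fun x => expi ((alpha + 2 * pi * (N%:Z - 1)%:~R) * x).
  by apply/funext => x; rewrite /u_ii addrC intrB -pmulrn.
have expi_L2 c : inL2_R2 dom (fun x : R => expi (c * x)).
  by rewrite expi_phase_jump; exact: phase_jump_L2.
have dev_i : alpha + 2 * pi * (N%:Z)%:~R - 2 * pi * N%:R = alpha.
  by rewrite -pmulrn addrK.
have dev_ii : alpha + 2 * pi * (N%:Z - 1)%:~R - 2 * pi * N%:R = alpha - 2 * pi.
  by rewrite intrB -pmulrn; ring.
have sqr_sym : (alpha - 2 * pi) ^+ 2 = (2 * pi - alpha) ^+ 2 by ring.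
have least_i : case_i -> forall k : int,
    alpha ^+ 2 <= (alpha + 2 * pi * k%:~R - 2 * pi * N%:R) ^+ 2.
  move=> [_ /andP[_ api]] k.
  have [->|->|[/ltW //]] := turns_cases N k alpha_ge0 alpha_lt2pi.
    by rewrite dev_i.
  by rewrite dev_ii; nra.
have least_ii : case_ii -> forall k : int,
    (2 * pi - alpha) ^+ 2 <= (alpha + 2 * pi * k%:~R - 2 * pi * N%:R) ^+ 2.
  move=> [_ /andP[pia _]] k.
  have [->|->|[_ h]] := turns_cases N k alpha_ge0 alpha_lt2pi.
  - by rewrite dev_i; nra.
  - by rewrite dev_ii sqr_sym.
  - by apply/ltW/h; exact: lt_le_trans pia.
have min_i (h : case_i) := @no_jump_minimizers R L N alpha N%:Z _ L_gt0 erefl.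
have min_ii (h : case_ii) := @no_jump_minimizers R L N alpha (N%:Z - 1) _ L_gt0 erefl.
rewrite dev_i -u_iE in min_i; rewrite dev_ii sqr_sym -u_iiE in min_ii.
have {}min_i (h : case_i) := min_i h (least_i h) h.1.
have {}min_ii (h : case_ii) := min_ii h (least_ii h) h.1.
have min_iii : case_iii -> [/\ expi alpha <> expi 0,
    forall v, ((2 * Num.sqrt 2 / 3)%:E <= E0 L N alpha v)%E &
    forall u, (E0 L N alpha u <= (2 * Num.sqrt 2 / 3)%:E)%E ->
      exists2 p, 0 <= p <= 1 & ae_eq_dom u (one_jump N alpha p)].
  move=> [big_i big_ii]; apply: jump_minimizers => // k.
  have [->|->|[h _]] := turns_cases N k alpha_ge0 alpha_lt2pi.
  - by rewrite dev_i.
  - by rewrite dev_ii sqr_sym.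
  - by rewrite (lt_trans big_i)// ltr_pM2l.
have iii_L2 p : inL2_R2 dom (u_iii p).
  by rewrite /u_iii one_jump_phase_jump; exact: phase_jump_L2.
have minE u v : inL2_R2 dom u -> inL2_R2 dom v -> ae_eq_dom u v ->
    (forall w, (E0 L N alpha v <= E0 L N alpha w)%E) -> global_minimizer L N alpha u.
  by move=> u2 v2 uv vmin; split=> // w _; rewrite (E0_ae L N alpha u2 v2 uv).
have min_iii_p p : case_iii -> 0 <= p <= 1 ->
    forall w, (E0 L N alpha (u_iii p) <= E0 L N alpha w)%E.
  by move=> /min_iii[ne low _] p01 w; rewrite E0_one_jump.
have half := @half_in01 R.
split.
- move=> cases u u2; split; last first.
    case=> [[h uE]|[h uE]|[h uE]].
    + by apply: (minE _ u_i) uE _ => //; [rewrite u_iE|have [] := min_i h].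
    + by apply: (minE _ u_ii) uE _ => //; [rewrite u_iiE|have [] := min_ii h].
    + case: uE => [[x0 [/andP[x00 x01] uE]]|uE|uE].
      * apply: (minE _ (u_iii x0)) uE _ => //; apply: min_iii_p => //.
        by rewrite !ltW.
      * apply: (minE _ (u_iii 0)) uE _ => //; apply: min_iii_p => //.
        by rewrite lexx ler01.
      * apply: (minE _ (u_iii 1)) uE _ => //; apply: min_iii_p => //.
        by rewrite lexx ler01.
  move=> [_ umin]; case: cases => [h|[h|h]].
  + have [_ /(_ u)] := min_i h; case=> [|k [kE uE]].
      by apply: umin; rewrite u_iE.
    have [kN|kN|[lt_k _]] := turns_cases N k alpha_ge0 alpha_lt2pi.
    * by constructor 1; split=> //; rewrite u_iE -kN.
    (* the two competitors tie: alpha = pi *)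
    * constructor 2; rewrite u_iiE -kN; split=> //.
      move: kE; rewrite kN dev_ii; case: h => Lh /andP[_ api] kE.
      have alphaE : alpha = pi by nra.
      split; last by rewrite alphaE lexx; lra.
      by rewrite -sqr_sym kE.
    * by rewrite kE ltxx in lt_k.
  + have [_ /(_ u)] := min_ii h; case=> [|k [kE uE]].
      by apply: umin; rewrite u_iiE.
    have [kN|kN|[_ lt_k]] := turns_cases N k alpha_ge0 alpha_lt2pi.
    (* the two competitors tie: alpha = pi *)
    * constructor 1; rewrite u_iE -kN; split=> //.
      move: kE; rewrite kN dev_i; case: h => Lh /andP[pia _] kE.
      have alphaE : alpha = pi by nra.
      split; last by rewrite alphaE lexx ltW.
      by rewrite kE.
    * by constructor 2; split=> //; rewrite u_iiE -kN.
    * have /andP[pia _] := h.2; move: (lt_k (lt_le_trans pi0 pia)).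
      by rewrite kE ltxx.
  + have [ne low char] := min_iii h.
    have [|p /andP[p0 p1] uE] := char u.
      by rewrite -(E0_one_jump L N ne (p := 0)) ?lexx ?ler01//; apply: umin; exact: iii_L2.
    constructor 3; split=> //.
    have [pE|p_neq0] := eqVneq p 0; first by constructor 2; rewrite /u_iii -pE.
    have [pE|p_neq1] := eqVneq p 1; first by constructor 3; rewrite /u_iii -pE.
    constructor 1; exists p; split=> //.
    by rewrite !lt_neqAle p0 p1 p_neq1 eq_sym p_neq0.
- move=> _; rewrite /u_i expi_phase_jump; split.
    have <- := @phase_jump_set_expi R alpha (2 * pi * N%:R + alpha) (expi_N_turns alpha N).
    exact: phase_jump_has_jump_set.
  exact: phase_jump_constant_twist.
- move=> _; rewrite /u_ii expi_phase_jump; split; last exact: phase_jump_constant_twist.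
  have e : expi (2 * pi * (N%:R - 1) + alpha) = expi alpha.
    by rewrite -[RHS](expi_periodic alpha (N%:Z - 1)) intrB -pmulrn addrC.
  by have <- := phase_jump_set_expi e; exact: phase_jump_has_jump_set.
- move=> /min_iii[ne _ _] x0 x01; rewrite /u_iii one_jump_phase_jump; split.
    have <- := phase_jump_set_one_jump N ne x01; exact: phase_jump_has_jump_set.
  exact: phase_jump_constant_twist.
Qed.
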